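(* If $\lambda_p:=p(2n-1)=1+\sigma$ is uniformly bounded from above and $\sigma\gg n^{-1/3}$, then $F(n,p)$ is unsatisfiable with probability $1-e^{-\Theta(\sigma^3n)}$, i.e. $$\Pr[F(n,p)\text{ is satisfiable}]=e^{-\Theta(\sigma^3n)}.$$
   Context: There are $n$ Boolean variables and $2n$ literals (each variable and its negation). A clause is a disjunction $(y\vee z)$ of two literals with different underlying variables. The random $2$-SAT formula $F(n,p)$ is obtained by selecting each of the $2^2\binom n2$ possible clauses with probability $p$, independently. A formula is satisfiable if some truth assignment of the $n$ variables satisfies all its clauses. Asymptotics are as $n\to\infty$ with $p=p(n)$, $\sigma=\sigma(n)$; $f\gg g$ means $f/g\to\infty$. *)

(* Defs.v *)
From mathcomp Require Import all_boot all_order all_algebra.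
From mathcomp Require Import all_classical all_reals all_analysis.
Import Order.TTheory GRing.Theory Num.Theory numFieldNormedType.Exports.

Set Implicit Arguments.
Unset Strict Implicit.
Unset Printing Implicit Defensive.

Local Open Scope ring_scope.

(* (i, true) is the variable i and (i, false) is its negation. *)
Definition literal (n : nat) := ('I_n * bool)%type.

(* A clause is the unordered pair of its two literals. *)
Definition is_clause (n : nat) (C : {set literal n}) : bool :=
  [exists y : literal n, exists z : literal n,
     (y.1 != z.1) && (C == [set y; z])].

Definition clause (n : nat) := {C : {set literal n} | is_clause C}.

Definition formula (n : nat) := {set clause n}.

Definition lit_true (n : nat) (a : {ffun 'I_n -> bool}) (l : literal n) : bool :=
  a l.1 == l.2.

Definition satisfiable (n : nat) (F : formula n) : bool :=
  [exists a : {ffun 'I_n -> bool},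
     forall C in F, exists l in val C, lit_true a l].

(* Probability that F(n, p) lies in the event E: the clauses are included
   independently, each with probability p. *)
Definition Pr_formula (R : realType) (n : nat) (p : R) (E : pred (formula n)) : R :=
  \sum_(F : formula n | E F) \prod_(C : clause n) (if C \in F then p else 1 - p).

(* f >> g as the argument tends to infinity. *)
Definition much_larger (R : realType) (f g : nat -> R) : Prop :=
  ((f n / g n) @[n --> \oo] --> +oo)%classic.

(* Main.v *)
(* A formula is read as the digraph of the implications ~y -> z and ~z -> y of its
   clauses (y \/ z); a literal x is in the spine if x leads to ~x.  Write
   lam = 2 n p, so that lam - 1 is about sigma.

   Lower bound.  Raise the clause probabilities one clause at a time from the
   subcritical value lam = 1 - sigma, where an unsatisfiable formula contains a
   bicycle and the expected number of bicycles is O(1 / (sigma^3 n)).  By Harris'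
   inequality each clause lowers the probability of satisfiability by a factor at
   least 1 - O(sigma / n) Pr[both literals in the spine], and this last probability
   is O(sigma^2): within 1 / sigma steps a walk from x to ~x either survives, as an
   almost critical branching process does with probability O(sigma), or closes up,
   which happens with probability O(1 / (sigma^2 n)).  There are O(n^2) clauses.

   Upper bound.  Split the clauses into two independent rounds, the first one still
   supercritical.  A depth-first search of the first round (Krivelevich and Sudakov)
   yields, outside an event of probability exp(- c sigma^3 n), a literal r with a
   linear number c sigma n of descendants and c sigma^2 n ancestors; a second search
   from the negated ancestors, among untouched variables, gives ~r as many
   descendants.  A clause of the second round negating two descendants of r makes r
   lead to ~r, likewise for ~r, and there are order sigma^2 n^2 such clauses, each
   present with probability of order sigma / n. *)
Require Import Defs.
From mathcomp Require Import all_boot all_order all_algebra.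
From mathcomp Require Import all_classical all_reals all_analysis.
From mathcomp Require Import fintype finset zify ring lra.
Import Order.TTheory GRing.Theory Num.Theory numFieldNormedType.Exports.

Set Implicit Arguments.
Unset Strict Implicit.
Unset Printing Implicit Defensive.

Local Open Scope ring_scope.

(** * Product measures on the subsets of a finite type *)

(** All probabilities are finite sums against product measures whose weights may differ from clause
    to clause, so that conditioning on clauses being present or absent gives a measure of the same
    kind. A clause can be traversed in two directions, so a walk could meet its own clauses again.
    Confining a walk to variables not yet visited makes the clause of a step independent of the
    continuation, and turns closing up into a separate event. Two literals being in the spine are
    increasing events, for which Harris' inequality points the wrong way; revealing a witness for
    one of them gets around this. The closing-up term 1 / (sigma^2 n) is O(sigma) exactly because
    sigma^3 n is bounded below. In the upper bound a search from a single root would die out with a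
    probability that is not exponentially small. Each search therefore starts from order sigma^2 n
    roots. A supermartingale whose factor per success is 1 - theta, with theta of order sigma, then
    tolerates a deficit of that many literals at the price exp(- c sigma^3 n). *)

Section Expectation.
Context {R : realFieldType} {I : finType}.
Implicit Types (w : I -> R) (h g : {set I} -> R) (F : {set I}) (c : I).

Definition weight w F : R := \prod_i (if i \in F then w i else 1 - w i).
Definition Ex w h : R := \sum_F weight w F * h F.
Definition upd w c (b : R) : I -> R := fun i => if i == c then b else w i.
Definition is_prob w := forall i, 0 <= w i <= 1.
Definition mono h := forall F F', F \subset F' -> h F <= h F'.

Lemma eq_Ex w w' h h' : w =1 w' -> h =1 h' -> Ex w h = Ex w' h'.
Proof.
move=> ew eh; apply: eq_bigr => F _; rewrite eh; congr (_ * _).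
by apply: eq_bigr => i _; rewrite ew.
Qed.

Lemma Ex_pair w h c :
  Ex w h = \sum_(F : {set I} | c \notin F)
    (\prod_(i | i != c) (if i \in F then w i else 1 - w i)) *
    (w c * h (c |: F) + (1 - w c) * h F).
Proof.
rewrite /Ex (bigID (fun F : {set I} => c \in F)) /=.
rewrite (reindex_onto (fun F : {set I} => c |: F) (fun F : {set I} => F :\ c)) /=; last first.
  by move=> F cF; rewrite setD1K.
rewrite [X in X + _ = _](_ : _ = \sum_(F : {set I} | c \notin F) weight w (c |: F) * h (c |: F)); last first.
  apply: eq_bigl => F; rewrite setU11 /=.
  apply/eqP/idP => [<-|cF]; first by rewrite setD11.
  by rewrite setU1K.
rewrite -big_split /=; apply: eq_bigr => F cF.
rewrite /weight (bigD1 c) //= setU11 [in X in _ + X](bigD1 c) //= (negbTE cF).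
rewrite (eq_bigr (fun i => if i \in F then w i else 1 - w i)); last first.
  by move=> i ic; rewrite in_setU1 (negbTE ic).
ring.
Qed.

Lemma Ex_split w h c :
  Ex w h = w c * Ex (upd w c 1) h + (1 - w c) * Ex (upd w c 0) h.
Proof.
rewrite !(Ex_pair _ _ c) !mulr_sumr -big_split /=; apply: eq_bigr => F cF.
rewrite /upd eqxx.
have e b : \prod_(i | i != c) (if i \in F then (if i == c then b else w i)
      else 1 - (if i == c then b else w i)) =
    \prod_(i | i != c) (if i \in F then w i else 1 - w i).
  by apply: eq_bigr => i /negbTE->.
by rewrite !e; ring.
Qed.

Lemma Ex_upd_set w h c b b' :
  Ex (upd w c b) (fun F => h (c |: F)) = Ex (upd w c b') (fun F => h (c |: F)).
Proof.
rewrite !(Ex_pair _ _ c); apply: eq_bigr => F cF.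
rewrite setUA setUid /upd eqxx.
under eq_bigr => i /negbTE ic do rewrite ic.
under [in RHS]eq_bigr => i /negbTE ic do rewrite ic.
by ring.
Qed.

Lemma Ex_upd1 w h c : Ex (upd w c 1) h = Ex (upd w c 1) (fun F => h (c |: F)).
Proof.
rewrite !(Ex_pair _ _ c); apply: eq_bigr => F cF.
by rewrite setUA setUid; congr (_ * _); rewrite /upd eqxx subrr !mul0r.
Qed.

Lemma Ex_upd0 w h c : Ex (upd w c 0) h = Ex (upd w c 0) (fun F => h (F :\ c)).
Proof.
rewrite !(Ex_pair _ _ c); apply: eq_bigr => F cF.
rewrite setU1K // (_ : F :\ c = F); last by apply/setDidPl; rewrite disjoint_sym disjoints1.
by congr (_ * _); rewrite /upd eqxx !mul0r.
Qed.

Lemma Ex_upd_indep w h c b : (forall F, h (c |: F) = h F) ->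
  Ex (upd w c b) h = Ex w h.
Proof.
move=> hc; have e w' : Ex w' h = Ex w' (fun F => h (c |: F)).
  by apply: eq_Ex => // F; rewrite hc.
by rewrite e [RHS]e [RHS](Ex_split _ _ c) !(Ex_upd_set w h c _ b); ring.
Qed.

Lemma ExD w h g : Ex w (fun F => h F + g F) = Ex w h + Ex w g.
Proof. by rewrite /Ex -big_split; apply: eq_bigr => F _; rewrite /= mulrDr. Qed.

Lemma ExZ w a h : Ex w (fun F => a * h F) = a * Ex w h.
Proof. by rewrite /Ex mulr_sumr; apply: eq_bigr => F _; rewrite mulrCA. Qed.

Lemma ExB w h g : Ex w (fun F => h F - g F) = Ex w h - Ex w g.
Proof.
rewrite ExD -[in RHS]mulN1r -ExZ; congr (_ + _).
by apply: eq_Ex => // F; rewrite mulN1r.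
Qed.

Lemma Ex_sum w (J : Type) (s : seq J) (P : pred J) (h : J -> {set I} -> R) :
  Ex w (fun F => \sum_(j <- s | P j) h j F) = \sum_(j <- s | P j) Ex w (h j).
Proof.
rewrite /Ex exchange_big /=; apply: eq_bigr => F _; exact: mulr_sumr.
Qed.

Lemma weight_ge0 w F : is_prob w -> 0 <= weight w F.
Proof.
move=> pw; apply: prodr_ge0 => i _; have /andP[w0 w1] := pw i.
by case: ifP => _; rewrite ?subr_ge0.
Qed.

Lemma le_Ex w h g : is_prob w -> (forall F, h F <= g F) -> Ex w h <= Ex w g.
Proof. by move=> pw hg; apply: ler_sum => F _; rewrite ler_wpM2l ?weight_ge0. Qed.

Lemma Ex_ge0 w h : is_prob w -> (forall F, 0 <= h F) -> 0 <= Ex w h.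
Proof. by move=> pw h0; apply: sumr_ge0 => F _; rewrite mulr_ge0 ?weight_ge0. Qed.

Lemma upd_prob w c b : is_prob w -> 0 <= b <= 1 -> is_prob (upd w c b).
Proof. by move=> pw pb i; rewrite /upd; case: eqP. Qed.

Lemma prob01 : (0 <= (0 : R) <= 1) * (0 <= (1 : R) <= 1).
Proof. by rewrite !lexx !ler01. Qed.

Lemma upd_prob0 w c : is_prob w -> is_prob (upd w c 0).
Proof. by move=> pw; apply: upd_prob; rewrite ?prob01. Qed.
Lemma upd_prob1 w c : is_prob w -> is_prob (upd w c 1).
Proof. by move=> pw; apply: upd_prob; rewrite ?prob01. Qed.

(* Fixing the coordinates one at a time reduces a statement about all product
   measures to the deterministic ones. *)
Lemma weight_ind (P : (I -> R) -> Prop) :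
  (forall w, is_prob w -> (forall i, (w i == 0) || (w i == 1)) -> P w) ->
  (forall w c, is_prob w -> P (upd w c 1) -> P (upd w c 0) -> P w) ->
  forall w, is_prob w -> P w.
Proof.
move=> Pdet Pstep w; have [m] := ubnP #|[set i | (w i != 0) && (w i != 1)]|.
elim: m w => // m IH w; rewrite ltnS => wm pw.
have [det|] := boolP [forall i, (w i == 0) || (w i == 1)].
  by apply: Pdet => // i; exact: (forallP det).
rewrite negb_forall => /existsP[c]; rewrite negb_or => c01.
have sub (b : R) : (b == 0) || (b == 1) ->
    (#|[set i | (upd w c b i != 0%R) && (upd w c b i != 1%R)]| < m)%N.
  move=> b01; apply: leq_trans wm; apply: proper_card; apply/properP; split.
    apply/subsetP => i; rewrite !inE /upd; have [_|//] := eqVneq i c.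
    by rewrite -negb_or b01.
  by exists c; rewrite !inE // /upd eqxx -negb_or b01.
apply: (Pstep w c) => //; apply: IH; rewrite ?sub ?eqxx ?orbT //.
- exact: upd_prob1.
- exact: upd_prob0.
Qed.

Lemma Ex_det w h : (forall i, (w i == 0) || (w i == 1)) ->
  Ex w h = h [set i | w i == 1].
Proof.
move=> det; rewrite /Ex (bigD1 [set i | w i == 1]) //= big1 ?addr0.
  rewrite /weight big1 ?mul1r // => i _; rewrite inE; case: ifP => [/eqP //|w1].
  by have := det i; rewrite w1 orbF => /eqP->; rewrite subr0.
move=> F neF; suff -> : weight w F = 0 by rewrite mul0r.
apply/eqP; rewrite prodf_seq_eq0; apply/hasP.
have [i Fi] : exists i, (i \in F) != (w i == 1).
  apply/existsP; move: neF; apply: contraR; rewrite negb_exists => /forallP e.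
  by apply/eqP/setP => i; rewrite inE; have := e i; rewrite negbK => /eqP.
exists i; rewrite ?mem_index_enum //=; have := det i.
move: Fi; case: (i \in F); have [->|w1] := eqVneq (w i) 1 => //= _.
  by rewrite orbF.
by rewrite subrr eqxx.
Qed.

Lemma Ex_cst w a : Ex w (fun=> a) = a.
Proof.
rewrite /Ex -mulr_suml /weight.
have -> : \sum_(F : {set I}) \prod_i (if i \in F then w i else 1 - w i) =
    \prod_i (w i + (1 - w i)).
  rewrite [in RHS](eq_bigr (fun i => \sum_(b : bool) (if b then w i else 1 - w i)));
    last by move=> i _; rewrite big_bool.
  rewrite bigA_distr_bigA /= (reindex (fun f : {ffun I -> bool} => [set i | f i])).
    by apply: eq_bigr => f _; apply: eq_bigr => i _; rewrite inE.
  exists (fun F : {set I} => [ffun i => i \in F]) => [f _|F _].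
    by apply/ffunP => i; rewrite ffunE inE.
  by apply/setP => i; rewrite inE ffunE.
by rewrite big1 ?mul1r // => i _; rewrite addrC subrK.
Qed.

Lemma Ex_upd01_mono w h c : is_prob w -> mono h ->
  Ex (upd w c 0) h <= Ex (upd w c 1) h.
Proof.
move=> pw mh; rewrite Ex_upd1 (Ex_upd_set w h c 1 0); apply: le_Ex.
  exact: upd_prob0.
by move=> F; apply: mh; exact: subsetUr.
Qed.

Lemma Ex_mono_weight w w' h : is_prob w -> is_prob w' -> mono h ->
  (forall i, w i <= w' i) -> Ex w h <= Ex w' h.
Proof.
move=> pw pw' mh; move: w' pw' w pw; apply: weight_ind => [w' pw' det|w' c pw' IH1 IH0] w pw ww'.
  (* For deterministic [w'], a set of positive weight under [w <= w'] lies inside the set where [w']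
     is 1. *)
  suff e F : weight w F * h F <= weight w F * h [set i | w' i == 1].
    rewrite [leRHS]Ex_det // (le_trans (ler_sum _ (fun F _ => e F))) //.
    by rewrite -[X in X <= _]/(Ex w (fun=> _)) Ex_cst.
  have [->|w0] := eqVneq (weight w F) 0; first by rewrite !mul0r.
  rewrite ler_wpM2l ?weight_ge0 //; apply: mh; apply/subsetP => i Fi; rewrite inE.
  have := det i; case: (eqVneq (w' i) 0) => // w'0 _; case/eqP: w0.
  apply/eqP; rewrite prodf_seq_eq0; apply/hasP; exists i; rewrite ?mem_index_enum //=.
  rewrite Fi eq_le; have := ww' i; have /andP[-> _] := pw i.
  by rewrite w'0 => ->.
have le1 : Ex (upd w c 1) h <= Ex (upd w' c 1) h.
  by apply: IH1; [exact: upd_prob1|move=> i; rewrite /upd; case: eqP].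
have le0 : Ex (upd w c 0) h <= Ex (upd w' c 0) h.
  by apply: IH0; [exact: upd_prob0|move=> i; rewrite /upd; case: eqP].
have := Ex_upd01_mono c pw' mh.
rewrite (Ex_split w h c) (Ex_split w' h c).
have /andP[? ?] := pw c; have := ww' c; have /andP[? ?] := pw' c; nra.
Qed.

(** Mixing the two values of one coordinate contributes the covariance q (1 - q) (H1 - H0) (G1 -
    G0), which is nonnegative because both functions increase in that coordinate. *)
Lemma Harris w h g : is_prob w -> mono h -> mono g ->
  Ex w h * Ex w g <= Ex w (fun F => h F * g F).
Proof.
move=> pw mh mg; move: w pw; apply: weight_ind => [w pw det|w c pw IH1 IH0].
  by rewrite !Ex_det.
have := Ex_upd01_mono c pw mh; have := Ex_upd01_mono c pw mg.
rewrite (Ex_split w h c) (Ex_split w g c) (Ex_split w (fun F => _) c).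
move: IH1 IH0; have := pw c.
set H1 := Ex _ h; set H0 := Ex _ h; set G1 := Ex _ g; set G0 := Ex _ g.
set E1 := Ex _ _; set E0 := Ex _ _; move: (w c) => q /andP[q0 q1] e1 e0 g01 h01.
have : 0 <= q * (1 - q) * ((H1 - H0) * (G1 - G0)).
  by rewrite !mulr_ge0 // ?subr_ge0.
have : 0 <= q * (E1 - H1 * G1) by rewrite mulr_ge0 ?subr_ge0.
have : 0 <= (1 - q) * (E0 - H0 * G0) by rewrite mulr_ge0 ?subr_ge0.
nra.
Qed.

Lemma Harris_anti w h g : is_prob w -> mono h -> mono (fun F => - g F) ->
  Ex w (fun F => h F * g F) <= Ex w h * Ex w g.
Proof.
move=> pw mh mg; have := Harris pw mh mg.
have e (f : {set I} -> R) : Ex w (fun F => - f F) = - Ex w f.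
  by rewrite -mulN1r -ExZ; apply: eq_Ex => // F; rewrite mulN1r.
rewrite e mulrN (eq_Ex (fun=> erefl) (fun F => mulrN (h F) (g F))) e.
by rewrite lerN2.
Qed.

End Expectation.

(** * Events: positive correlation and conditioning *)

Section Probability.
Context {R : realFieldType} {I : finType}.
Implicit Types (w : I -> R) (h g : {set I} -> R) (F T : {set I}) (c : I).
Implicit Types (A B : pred {set I}).

Definition Pr w A : R := Ex w (fun F => (A F)%:R).
Definition increasing A := forall F F' : {set I}, F \subset F' -> A F -> A F'.

Lemma increasing_mono A : increasing A -> mono (fun F => (A F)%:R : R).
Proof. by move=> iA F F' FF'; rewrite ler_nat; case: (A F) (iA _ _ FF') => // ->. Qed.

Lemma eq_Pr w A B : A =1 B -> Pr w A = Pr w B.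
Proof. by move=> e; apply: eq_Ex => // F; rewrite e. Qed.

Lemma le_Pr w A B : is_prob w -> (forall F, A F -> B F) -> Pr w A <= Pr w B.
Proof. by move=> pw AB; apply: le_Ex => // F; rewrite ler_nat; case: (A F) (AB F) => // ->. Qed.

Lemma Pr_ge0 w A : is_prob w -> 0 <= Pr w A.
Proof. by move=> pw; apply: Ex_ge0 => // F; rewrite ler0n. Qed.

Lemma Pr_le1 w A : is_prob w -> Pr w A <= 1.
Proof.
by move=> pw; rewrite -(Ex_cst w 1); apply: le_Ex => // F; case: (A F); rewrite ?ler01.
Qed.

Lemma PrC w A : Pr w (predC A) = 1 - Pr w A.
Proof.
rewrite -(Ex_cst w 1) -ExB; apply: eq_Ex => // F /=.
by case: (A F); rewrite ?subrr ?subr0.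
Qed.

Lemma Pr_or w A B : is_prob w -> Pr w (fun F => A F || B F) <= Pr w A + Pr w B.
Proof.
move=> pw; rewrite -ExD; apply: le_Ex => // F; rewrite -natrD ler_nat.
by case: (A F); case: (B F).
Qed.

Lemma Pr_exists_le w (J : finType) (P : pred J) (A : J -> pred {set I}) : is_prob w ->
  Pr w (fun F => [exists (j | P j), A j F]) <= \sum_(j | P j) Pr w (A j).
Proof.
move=> pw; rewrite -Ex_sum; apply: le_Ex => // F.
case: existsP => [[j /andP[Pj Aj]]|_]; last by apply: sumr_ge0 => j _; exact: ler0n.
by rewrite (bigD1 j) //= Aj lerDl sumr_ge0 // => k _; exact: ler0n.
Qed.

Lemma Pr_mem_indep w c A : (forall F, A (c |: F) = A F) ->
  Pr w (fun F => (c \in F) && A F) = w c * Pr w A.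
Proof.
move=> hA; have hA' b : Ex (upd w c b) (fun F => (A F)%:R) = Pr w A.
  by apply: Ex_upd_indep => F; rewrite hA.
rewrite /Pr (Ex_split w _ c) Ex_upd1 Ex_upd0.
rewrite (eq_Ex (fun=> erefl) (_ : _ =1 (fun F => (A F)%:R))) => [|F]; last first.
  by rewrite setU11 /= hA.
rewrite hA' (eq_Ex (fun=> erefl) (_ : _ =1 (fun=> 0))) => [|F]; last first.
  by rewrite setD11.
by rewrite Ex_cst mulr0 addr0.
Qed.

Lemma Pr_mem w c : Pr w (fun F => c \in F) = w c.
Proof.
rewrite -[RHS]mulr1 -[X in _ = _ * X](Ex_cst w) -[Ex w _]/(Pr w predT) -Pr_mem_indep //.
by apply: eq_Pr => F; rewrite andbT.
Qed.

(** Inclusion-exclusion, with Harris' inequality for the intersection: a union of increasing events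
    is at most as likely as if they were independent. This is how walks come to be dominated by a
    branching process. *)
Lemma Pr_or_Harris w A B : is_prob w -> increasing A -> increasing B ->
  Pr w (fun F => A F || B F) <= 1 - (1 - Pr w A) * (1 - Pr w B).
Proof.
move=> pw iA iB; have := Harris pw (increasing_mono iA) (increasing_mono iB).
rewrite -!/(Pr w _) => H.
have -> : Pr w (fun F => A F || B F) =
    Pr w A + Pr w B - Ex w (fun F => (A F)%:R * (B F)%:R).
  rewrite -ExD -ExB; apply: eq_Ex => // F.
  by case: (A F); case: (B F); rewrite /= ?mulr1 ?mulr0 ?subr0 ?addr0 ?add0r ?addrK.
by move: H; set x := Pr w A; set y := Pr w B; set z := Ex _ _; nra.
Qed.

Lemma Pr_has_Harris w (J : eqType) (s : seq J) (A : J -> pred {set I}) : is_prob w ->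
  (forall j, increasing (A j)) ->
  Pr w (fun F => has (A^~ F) s) <= 1 - \prod_(j <- s) (1 - Pr w (A j)).
Proof.
move=> pw iA; elim: s => [|j s IH].
  by rewrite big_nil subrr /= /Pr Ex_cst.
rewrite big_cons /=.
have is_ : increasing (fun F => has (A^~ F) s).
  by move=> F F' FF' /hasP[k ks Ak]; apply/hasP; exists k => //; exact: iA Ak.
apply: le_trans (Pr_or_Harris pw (iA j) is_) _.
by rewrite lerD2l lerN2 ler_wpM2l ?subr_ge0 ?Pr_le1 // -lerN2 -(lerD2l 1) subKr.
Qed.

(** The law of F given that it contains T, as [Ex_force] shows. *)
Definition force w T : I -> R := fun i => if i \in T then 1 else w i.

Lemma force_prob w T : is_prob w -> is_prob (force w T).
Proof. by move=> pw i; rewrite /force; case: ifP => _; rewrite ?prob01. Qed.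

Lemma Ex_force w T h :
  Ex w (fun F => (T \subset F)%:R * h F) = (\prod_(i in T) w i) * Ex (force w T) h.
Proof.
move: h; have [m] := ubnP #|T|; elim: m T => // m IH T; rewrite ltnS => Tm h.
have [->|[c cT]] := set_0Vmem T.
  rewrite big_set0 mul1r; apply: eq_Ex => [i|F]; first by rewrite /force inE.
  by rewrite sub0set mul1r.
have cT' : (#|T :\ c| < m)%N by rewrite (leq_trans _ Tm) // [X in (_ < X)%N](cardsD1 c) cT.
have e F : (T \subset F)%:R * h F = ((T :\ c) \subset F)%:R * ((c \in F)%:R * h F) :> R.
  by rewrite -{1}(setD1K cT) subUset sub1set; case: (c \in F) => /=; rewrite ?mul1r // !mul0r mulr0.
rewrite (eq_Ex (fun=> erefl) e) IH // (big_setD1 c cT) /= -mulrA mulrCA; congr (_ * _).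
rewrite (Ex_split _ _ c) Ex_upd1 Ex_upd0 /force !inE eqxx /=.
rewrite [X in _ + _ * X](eq_Ex (fun=> erefl) (_ : _ =1 (fun=> 0))) => [|F]; last first.
  by rewrite setD11 mul0r.
rewrite Ex_cst mulr0 addr0; congr (_ * _).
rewrite (eq_Ex (fun=> erefl) (_ : _ =1 (fun F => h (c |: F)))) => [|F]; last first.
  by rewrite setU11 mul1r.
rewrite -Ex_upd1; apply: eq_Ex => // i; rewrite /upd !inE.
by case: (eqVneq i c) => [->|]; rewrite ?cT.
Qed.

(* Order the witnesses; given that T is the first one that is open, the other
   information is decreasing and hence only hurts B. *)
Lemma Pr_witness w (s : seq {set I}) B (beta : R) : is_prob w -> increasing B ->
  (forall T, T \in s -> Pr (force w T) B <= beta) ->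
  Pr w (fun F => has (fun T => T \subset F) s && B F) <=
    beta * Pr w (fun F => has (fun T => T \subset F) s).
Proof.
move=> pw iB; elim: s => [|T s IH] hs.
  by rewrite /= /Pr !Ex_cst mulr0.
set A := fun F => has (fun T => T \subset F) s.
have iA : increasing A.
  by move=> F F' FF' /hasP[U sU UF]; apply/hasP; exists U => //; exact: subset_trans FF'.
have beta_ge0 : 0 <= beta by apply: le_trans (hs T _); rewrite ?mem_head ?Pr_ge0 //; exact: force_prob.
have splitA F : (has (fun T => T \subset F) (T :: s))%:R =
    (A F)%:R + (T \subset F)%:R * (~~ A F)%:R :> R.
  by rewrite /= -/(A F); case: (A F); case: (T \subset F); rewrite /= ?mulr0 ?mulr1 ?mul0r ?addr0 ?add0r.
have -> : Pr w (fun F => has (fun T => T \subset F) (T :: s)) =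
    Pr w A + (\prod_(i in T) w i) * Pr (force w T) (predC A).
  by rewrite /Pr (eq_Ex (fun=> erefl) splitA) ExD Ex_force.
have -> : Pr w (fun F => has (fun T => T \subset F) (T :: s) && B F) =
    Pr w (fun F => A F && B F) +
    (\prod_(i in T) w i) * Ex (force w T) (fun F => (B F)%:R * (predC A F)%:R).
  rewrite /Pr -Ex_force -ExD; apply: eq_Ex => // F; rewrite /= -/(A F).
  by case: (A F); case: (T \subset F); case: (B F);
     rewrite /= ?(mulr0, mulr1, mul0r, addr0, add0r).
rewrite mulrDr lerD //; first by apply: IH => U sU; apply: hs; rewrite inE sU orbT.
rewrite mulrCA ler_wpM2l //; first by apply: prodr_ge0 => i _; case/andP: (pw i).
apply: le_trans (Harris_anti (force_prob T pw) (increasing_mono iB) _) _.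
  move=> F F' /iA; rewrite /= lerN2 ler_nat.
  by case: (A F) => [->//|_]; case: (A F').
by rewrite ler_wpM2r ?Pr_ge0 ?hs ?mem_head //; exact: force_prob.
Qed.

End Probability.

(** * Walks in the implication digraph *)

Section Implications.
Context {n : nat}.
Implicit Types (x y z u : literal n) (F T : formula n) (V S : {set 'I_n}).
Implicit Types (Z : {set literal n}) (c : clause n).

Definition neg x : literal n := (x.1, ~~ x.2).

Lemma negK : involutive neg.
Proof. by case=> i b; rewrite /neg /= negbK. Qed.

Lemma neg_neq x : neg x != x.
Proof. by case: x => i []; rewrite xpair_eqE andbF. Qed.

Lemma neg_inj : injective neg. Proof. exact: inv_inj negK. Qed.

Lemma same_var x y : x.1 = y.1 -> x = y \/ x = neg y.
Proof. by case: x y => [i []] [j []] /= ->; auto. Qed.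

Definition imp F x z : bool := [exists c in F, val c == [set neg x; z]].

Lemma imp_clause x z : x.1 != z.1 ->
  exists2 c, val c = [set neg x; z] & forall F, imp F x z = (c \in F).
Proof.
move=> xz; have cl : is_clause [set neg x; z].
  by apply/existsP; exists (neg x); apply/existsP; exists z; rewrite xz eqxx.
pose c0 : clause n := exist (fun C => is_true (is_clause C)) _ cl.
exists c0 => // F; apply/existsP/idP => [[c /andP[cF /eqP e]]|cF].
  by rewrite (_ : c0 = c) //; apply: val_inj; rewrite e.
by exists c0; rewrite cF /=.
Qed.

Lemma clause_var c : exists y z, y.1 != z.1 /\ val c = [set y; z].
Proof.
have /existsP[y /existsP[z /andP[yz /eqP e]]] := valP c.
by exists y, z.
Qed.

Lemma imp_var F x z : imp F x z -> x.1 != z.1.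
Proof.
case/existsP=> c /andP[_ /eqP e]; have [y [y' [yy' e']]] := clause_var c.
have : y \in val c by rewrite e' set21.
have : y' \in val c by rewrite e' set22.
rewrite e => /set2P hy' /set2P hy; apply/eqP => xz; case/negP: yy'.
by case: hy => ->; case: hy' => ->; rewrite /= ?xz.
Qed.

Lemma imp_contra F x z : imp F (neg z) (neg x) = imp F x z.
Proof. by apply: eq_existsb => c; rewrite negK setUC. Qed.

Lemma imp_mono F F' x z : F \subset F' -> imp F x z -> imp F' x z.
Proof.
move=> /subsetP FF' /existsP[c /andP[/FF' cF e]].
by apply/existsP; exists c; rewrite cF.
Qed.

Lemma imp_local F F' x z :
  (forall c, neg x \in val c -> (c \in F) = (c \in F')) -> imp F x z = imp F' x z.
Proof.
move=> h; apply: eq_existsb => c; case: eqP => [e|]; last by rewrite !andbF.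
by rewrite h // e set21.
Qed.

(* [walk b g k F x V Z]: following implications from x through new variables
   of V one can hit Z within k steps, or (if b) survive k steps; if g, the
   literals over the visited variables are added to Z. *)
Fixpoint walk (b g : bool) (k : nat) F x V Z : bool :=
  if k is k'.+1 then
    [exists z in Z, imp F x z] ||
    has (fun u => [&& u.1 \in V, imp F x u &
      walk b g k' F u (V :\ u.1) (if g then x |: (neg x |: Z) else Z)])
      (enum {: literal n})
  else b.

Lemma walk_mono b g k x V Z : increasing (fun F => walk b g k F x V Z).
Proof.
elim: k x V Z => [x V Z F F' _ //|k IH] x V Z F F' FF' /= /orP[/existsP[z /andP[zZ xz]]|].
  by apply/orP; left; apply/existsP; exists z; rewrite zZ (imp_mono FF').
case/hasP=> u _ /and3P[uV xu wu]; apply/orP; right; apply/hasP; exists u.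
  by rewrite mem_enum.
by rewrite uV (imp_mono FF') //= (IH _ _ _ F).
Qed.

(** A step from u reads only clauses containing [neg u]. This locality later makes the clause of a
    step independent of the continuation. *)
Lemma walk_local b g k F F' x V Z :
  (forall c u, (u == x) || (u.1 \in V) -> neg u \in val c -> (c \in F) = (c \in F')) ->
  walk b g k F x V Z = walk b g k F' x V Z.
Proof.
elim: k x V Z => //= k IH x V Z h.
have ix z : imp F x z = imp F' x z.
  by apply: imp_local => c; apply: h; rewrite eqxx.
congr (_ || _); first by apply: eq_existsb => z; rewrite ix.
apply: eq_has => u; rewrite ix; case uV: (u.1 \in V) => //=.
congr (_ && _); apply: IH => c u' /orP[/eqP->|].
  by apply: h; rewrite uV orbT.
by rewrite !inE => /andP[_ u'V]; apply: h; rewrite u'V orbT.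
Qed.

(** Follow the path to its first exit from V: the literal there lies in Z, its variable being
    neither in V nor that of the current literal. If b is false, [#|V| < k] leaves enough steps, as
    each of them uses up a variable. *)
Lemma path_walk b k F x V Z p :
  path (imp F) x p -> p != [::] -> (last x p).1 \notin V ->
  (forall l : literal n, l.1 \notin V -> l.1 != x.1 -> l \in Z) ->
  b || (#|V| < k)%N -> walk b true k F x V Z.
Proof.
elim: k x V Z p => [|k IH] x V Z [//|u p] /=; first by rewrite ltn0 orbF.
move=> /andP[xu pu] _ lV hZ bk.
have [uV|uV] := boolP (u.1 \in V); last first.
  apply/orP; left; apply/existsP; exists u; rewrite xu andbT.
  by apply: hZ => //; rewrite eq_sym (imp_var xu).
apply/orP; right; apply/hasP; exists u; rewrite ?mem_enum //= uV xu /=.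
apply: (IH _ _ _ p) => //.
- by case: p lV {pu} => //=; rewrite uV.
- by rewrite !inE (negbTE lV) andbF.
- move=> l; rewrite !inE => /nandP[/negbNE ->//|lV'] _.
  have [/same_var[]->|/(hZ _ lV')->] := eqVneq l.1 x.1; by rewrite ?eqxx ?orbT.
- by case/orP: bk => [->//|]; rewrite (cardsD1 u.1) uV add1n ltnS => ->; rewrite orbT.
Qed.

Lemma connect_walk k F x V Z : connect (imp F) x (neg x) -> x.1 \notin V ->
  (forall l : literal n, l.1 \notin V -> l.1 != x.1 -> l \in Z) ->
  walk true true k F x V Z.
Proof.
case/connectP=> p pp e xV hZ; apply: (path_walk pp) => //.
  by apply: contraNneq (neg_neq x) => p0; rewrite e p0.
by rewrite -e.
Qed.

Lemma connect_neg F x y : connect (imp F) (neg y) (neg x) = connect (imp F) x y.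
Proof.
have imp_connect u v : connect (imp F) u v -> connect (imp F) (neg v) (neg u).
  case/connectP=> p; elim: p u => [|z p IH] u /=; first by move=> _ ->.
  case/andP=> uz pz /(IH _ pz) h; apply: connect_trans h (connect1 _).
  by rewrite imp_contra.
by apply/idP/idP => /imp_connect; rewrite ?negK.
Qed.

(** Cut the walk at its first use of v: what precedes is a walk that hits a literal over v, with no
    other targets, hence [g] is false there. *)
Lemma walk_avoid k F x V Z (v : 'I_n) : walk true true k F x V Z ->
  walk true true k F x (V :\ v) Z ||
  walk false false k F x V [set (v, true); (v, false)].
Proof.
elim: k x V Z => //= k IH x V Z /orP[->//|/hasP[u _ /and3P[uV xu wu]]].
have [uv|uv] := eqVneq u.1 v.
  rewrite orbC -orbA; apply/orP; left; apply/existsP; exists u; rewrite xu andbT.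
  by rewrite !inE; case: u uv {uV xu wu} => i [] /= ->; rewrite eqxx ?orbT.
case/orP: (IH _ _ _ wu) => w'; apply/orP; [left|right]; apply/orP; right;
  apply/hasP; exists u; rewrite ?mem_enum //= ?inE ?uv uV xu //=.
by rewrite setDDl setUC -setDDl.
Qed.

(** T is the set of clauses of a single walk, a witness small enough to be revealed: besides x and Z
    it touches at most k variables. *)
Lemma walk_support k F x V Z : walk true true k F x V Z ->
  exists S T, [/\ S \subset V, (#|S| <= k)%N, T \subset F,
    forall c l, c \in T -> l \in val c ->
      (l.1 \in x.1 |: S) || [exists z in Z, l.1 == z.1] &
    walk true true k T x V Z].
Proof.
elim: k x V Z => [|k IH] x V Z /=.
  by exists set0, set0; rewrite !sub0set cards0; split => // c l; rewrite inE.
case/orP=> [/existsP[z /andP[zZ xz]]|/hasP[u _ /and3P[uV xu wu]]].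
  have [c ec ic] := imp_clause (imp_var xz).
  exists set0, [set c]; rewrite sub0set cards0 sub1set -ic; split => //.
    move=> c' l /set1P->; rewrite ec !inE => /orP[]/eqP->; rewrite ?eqxx //.
    by apply/orP; right; apply/existsP; exists z; rewrite zZ eqxx.
  by apply/orP; left; apply/existsP; exists z; rewrite zZ ic set11.
have [S [T [SV Sk TF hT wT]]] := IH _ _ _ wu.
have [c ec ic] := imp_clause (imp_var xu).
exists (u.1 |: S), (c |: T); split.
- by rewrite subUset sub1set uV (subset_trans SV) ?subD1set.
- by rewrite cardsU1 -(add1n k) leq_add ?leq_b1.
- by rewrite subUset sub1set -ic xu.
- move=> c' l /setU1P[->|/hT h /h].
    by rewrite ec !inE => /orP[]/eqP->; rewrite eqxx ?orbT.
  rewrite !inE => /orP[/orP[]->|/existsP[z]]; rewrite ?orbT //.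
  rewrite !inE => /andP[/orP[/eqP->|/orP[/eqP->|zZ]] /eqP->]; rewrite ?eqxx //.
  by apply/orP; right; apply/existsP; exists z; rewrite zZ eqxx.
- apply/orP; right; apply/hasP; exists u; rewrite ?mem_enum //= uV ic setU11 /=.
  by apply: walk_mono wT; rewrite subsetUr.
Qed.

End Implications.

(** * Elementary inequalities behind the walk recursions *)

Section Numeric.
Context {R : realFieldType}.

(** Separates the branching part a, which keeps its second-order saving, from the error b, which is
    then merely added up along the recursion. *)
Lemma prod_1B_ge (J : Type) (s : seq J) (t : J -> R) (a b : R) :
  0 <= a <= 1 -> 0 <= b -> (forall j, 0 <= t j <= 1) -> (forall j, t j <= a + b) ->
  (1 - a) ^+ size s - b *+ size s <= \prod_(j <- s) (1 - t j).
Proof.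
move=> /andP[a0 a1] b0 t01 tab; elim: s => [|j s IH].
  by rewrite big_nil expr0 mulr0n subr0.
rewrite big_cons exprS mulrS /=.
have P0 : 0 <= \prod_(j <- s) (1 - t j).
  by apply: prodr_ge0 => i _; have /andP[_] := t01 i; rewrite subr_ge0.
have P1 : \prod_(j <- s) (1 - t j) <= 1.
  by apply: prodr_ile1 => i _; have /andP[? ?] := t01 i; apply/andP; split; lra.
have := tab j; have /andP[? ?] := t01 j.
have : b *+ size s >= 0 by rewrite mulrn_wge0.
have : 0 <= (1 - a) ^+ size s by rewrite exprn_ge0 // subr_ge0.
move: IH P0 P1; set P := \prod_(_ <- _) _; set A := _ ^+ _; set B := b *+ _.
move=> IH P0 P1 A0 B0 tjab.
have h1 : (1 - a) * (A - B) <= (1 - a) * P by rewrite ler_wpM2l // subr_ge0.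
have h2 : (1 - a - b) * P <= (1 - t j) * P by rewrite ler_wpM2r //; lra.
have h3 : b * P <= b by rewrite ler_piMr.
have h4 : 0 <= a * B by rewrite mulr_ge0.
nra.
Qed.

(* The Pade approximant of 1 - (1-t)^m. *)
Lemma pade_1B (m : nat) (t : R) : 0 <= t <= 1 ->
  1 - (1 - t) ^+ m.+1 <= m.+1%:R * t / (1 + m%:R * t / 2).
Proof.
case/andP=> t0 t1; elim: m => [|m IH].
  by rewrite expr1 mul1r mul0r mul0r addr0 divr1; lra.
have m0 : 0 <= m%:R * t by rewrite mulr_ge0.
rewrite ler_pdivlMr in IH; last by lra.
rewrite ler_pdivlMr; last by rewrite -natr1 mulrDl; lra.
rewrite exprS; move: IH m0; rewrite -[m.+2%:R]natr1 -[m.+1%:R]natr1.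
set A := (1 - t) ^+ m.+1; set M := m%:R * t => IH M0.
have e1 : (m%:R + 1) * t = M + t by rewrite mulrDl mul1r.
rewrite e1 in IH *.
have -> : (m%:R + 1 + 1) * t = M + t + t by rewrite !mulrDl mul1r.
have A1 : 1 - M / 2 - t <= A * (1 + M / 2) by nra.
have h : (1 - M / 2 - t) * (1 - t) * (1 + M / 2 + t / 2) <=
    A * (1 + M / 2) * (1 - t) * (1 + M / 2 + t / 2).
  by rewrite !ler_wpM2r //; lra.
have h2 : (1 - M / 2 - 3 * t / 2) * (1 + M / 2) <=
    (1 - M / 2 - t) * (1 - t) * (1 + M / 2 + t / 2) by nra.
have h3 : 0 < 1 + M / 2 by lra.
rewrite -(ler_pM2r h3); nra.
Qed.

(* The bound b_k = 4 lam^k / (k+4) solves 1 / b_(k+1) = (1 / b_k + 1/4) / lam. *)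
Lemma survival_step (m k : nat) (p lam al : R) :
  lam = m%:R * p -> 1 <= lam -> 0 <= p <= 2^-1 -> 0 <= al <= 1 ->
  al <= 4 * lam ^+ k / (k%:R + 4) ->
  1 - (1 - p * al) ^+ m <= 4 * lam ^+ k.+1 / (k.+1%:R + 4).
Proof.
move=> el lam1 /andP[p0 p2] /andP[al0 al1] alk.
have lk : 1 <= lam ^+ k by rewrite exprn_ege1.
have k0 : 0 <= k%:R :> R by [].
case: m el => [|m] el.
  rewrite expr0 subrr divr_ge0 ?mulr_ge0 ?exprn_ge0 //; lra.
apply: le_trans (pade_1B m _) _; first by nra.
rewrite (_ : m.+1%:R * (p * al) = lam * al); last by rewrite el; ring.
have D : m%:R * (p * al) = (lam - p) * al by rewrite el -natr1; ring.
rewrite D ler_pdivrMr; last by nra.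
rewrite ler_pdivlMr in alk; last by lra.
rewrite mulrAC ler_pdivlMr; last by rewrite -natr1; lra.
rewrite exprS -natr1.
move: lk alk; set L := lam ^+ k; set K := k%:R => lk alk.
(* As [lam - p >= 1/2], the Pade denominator is at least 1 + al / 4; then [1 <= lam ^+ k] pays for
   passing from k + 4 to k + 5. *)
have h1 : al / 4 <= (lam - p) * al / 2 by nra.
have h2 : al * (K + 5) <= 4 * L * (1 + al / 4) by nra.
have h3 : al * (K + 5) <= 4 * L * (1 + (lam - p) * al / 2) by nra.
have : lam * (al * (K + 5)) <= lam * (4 * L * (1 + (lam - p) * al / 2)).
  by rewrite ler_wpM2l //; lra.
nra.
Qed.

End Numeric.

(** * Survival and closing-up probabilities of walks *)

Section WalkProbability.
Context {R : realFieldType} {n : nat}.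
Implicit Types (x y z u : literal n) (F T : formula n) (V S : {set 'I_n}).
Implicit Types (Z : {set literal n}) (c : clause n) (w : clause n -> R) (p : R).

(* A step from u uses only clauses that contain [neg u]. *)
Definition light w p x V := forall c u,
  (u == x) || (u.1 \in V) -> neg u \in val c -> w c <= p.

Lemma Pr_imp_le w p x V z : is_prob w -> 0 <= p -> light w p x V ->
  Pr w (fun F => imp F x z) <= p.
Proof.
move=> pw p0 lw; have [xz|xz] := eqVneq x.1 z.1.
  rewrite (@eq_Pr _ _ _ _ pred0) ?[Pr _ _]Ex_cst // => F.
  by apply/negbTE/negP => /imp_var; rewrite xz eqxx.
have [c ec ic] := imp_clause xz.
rewrite (eq_Pr _ ic) Pr_mem (lw c x) ?eqxx // ec set21 //.
Qed.

(* The continuations through different u are positively correlated, so by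
   Harris' inequality survival is at most that of a branching process. *)
Lemma Pr_walk_step b g k w p x V Z (a be : R) : is_prob w -> 0 <= p <= 1 ->
  light w p x V -> x.1 \notin V -> 0 <= a <= 1 -> 0 <= be ->
  (forall u, u.1 \in V -> Pr w (fun F => walk b g k F u (V :\ u.1)
      (if g then x |: (neg x |: Z) else Z)) <= a + be) ->
  Pr w (fun F => walk b g k.+1 F x V Z) <=
    #|Z|%:R * p + (1 - (1 - p * a) ^+ (2 * n)) + (2 * n)%:R * p * be.
Proof.
move=> pw /andP[p0 p1] lw xV /andP[a0 a1] be0 IH.
apply: le_trans (Pr_or _ _ pw) _; rewrite -addrA; apply: lerD.
  apply: le_trans (Pr_exists_le (mem Z) (fun z F => imp F x z) pw) _.
  apply: le_trans (ler_sum _ (fun z _ => Pr_imp_le z pw p0 lw)) _.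
  by rewrite sumr_const mulr_natl.
set Z' := if g then _ else _ in IH *.
pose A u F := [&& u.1 \in V, imp F x u & walk b g k F u (V :\ u.1) Z'].
have iA u : increasing (A u).
  move=> F F' FF' /and3P[uV xu wu]; apply/and3P; split => //.
    exact: imp_mono xu.
  exact: walk_mono wu.
apply: le_trans (Pr_has_Harris _ pw iA) _.
have sz : size (enum {: literal n}) = (2 * n)%N.
  by rewrite -cardE card_prod card_ord card_bool mulnC.
have := @prod_1B_ge R _ (enum {: literal n}) (fun u => Pr w (A u)) (p * a) (p * be).
rewrite sz; have pa : 0 <= p * a <= 1 by apply/andP; split; nra.
have pb : 0 <= p * be by rewrite mulr_ge0.
move=> /(_ pa pb) H; have : forall u, 0 <= Pr w (A u) <= 1.
  by move=> u; rewrite Pr_ge0 ?Pr_le1.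
move=> /H{}H; rewrite -mulrA mulr_natl; have {}H := H _.
suff hA u : Pr w (A u) <= p * a + p * be by move: (H hA); lra.
have [uV|uV] := boolP (u.1 \in V); last first.
  rewrite (@eq_Pr _ _ _ _ pred0) ?[Pr _ _]Ex_cst; last by move=> F; rewrite /A (negbTE uV).
  by rewrite addr_ge0 //; case/andP: pa.
have xu : x.1 != u.1 by apply: contraNneq xV => ->.
have [c ec ic] := imp_clause xu.
rewrite (@eq_Pr _ _ _ _ (fun F => (c \in F) && walk b g k F u (V :\ u.1) Z')); last first.
  by move=> F; rewrite /A uV ic.
(* The clause of the step consists of [neg x] and u. The continuation could read it only from x or
   from [neg u]; the variable of x is outside V and that of u has just been removed. *)
rewrite Pr_mem_indep; last first.
  move=> F; apply: walk_local => c' u' hu' nu'; rewrite !inE.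
  case: eqP => // e; case/negP: xV; move: nu'; rewrite e ec !inE.
  case/orP: hu' => [/eqP->|]; last first.
    rewrite !inE => /andP[u'u u'V] /orP[/eqP/neg_inj <-//|/eqP e2].
    by case/eqP: u'u; rewrite -e2.
  by rewrite (negbTE (neg_neq u)) orbF => /eqP/neg_inj <-.
rewrite -mulrDr ler_pM ?Pr_ge0 ?IH //; first by case/andP: (pw c).
by apply: (lw c x); rewrite ?eqxx // ec set21.
Qed.

Lemma light_sub w p x V u : light w p x V -> u.1 \in V -> light w p u (V :\ u.1).
Proof.
move=> lw uV c u' /orP[/eqP->|]; first by apply: lw; rewrite uV orbT.
by rewrite !inE => /andP[_ u'V]; apply: lw; rewrite u'V orbT.
Qed.

Lemma setD1_notin V (i : 'I_n) : i \notin V :\ i. Proof. by rewrite !inE eqxx. Qed.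

Lemma card_grow x Z : (#|x |: (neg x |: Z)| <= #|Z| + 2)%N.
Proof.
by rewrite !cardsU1 addnA addnC leq_add2l; do 2!case: (_ \notin _).
Qed.

(** The first term bounds survival of the branching process. The second is a first moment for
    closing up: k levels, at most [lam ^+ k] walks expected at each, and at most |Z| + 2k targets,
    since each step adds the two literals of a variable. *)
Lemma Pr_walk_survive k w p x V Z (lam : R) : is_prob w -> 0 <= p <= 2^-1 ->
  lam = (2 * n)%:R * p -> 1 <= lam -> light w p x V -> x.1 \notin V ->
  Pr w (fun F => walk true true k F x V Z) <=
    4 * lam ^+ k / (k%:R + 4) + k%:R * (#|Z| + 2 * k)%:R * p * lam ^+ k.
Proof.
move=> pw /andP[p0 p2] el lam1; elim: k x V Z => [|k IH] x V Z lw xV.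
  by rewrite /= [Pr _ _]Ex_cst expr0 !mul0r addr0 add0r mulr1 divff // pnatr_eq0.
have lk : 1 <= lam ^+ k by rewrite exprn_ege1.
set bk := 4 * lam ^+ k / (k%:R + 4) in IH.
have bk0 : 0 <= bk by rewrite divr_ge0 ?addr_ge0 // mulr_ge0 //; lra.
set be := k%:R * (#|Z| + 2 + 2 * k)%:R * p * lam ^+ k.
have be0 : 0 <= be by rewrite !mulr_ge0 //; lra.
(* [Pr_walk_step] wants a to be a probability; where bk exceeds 1 the trivial bound takes over. *)
pose a := Num.min 1 bk.
have a01 : 0 <= a <= 1 by rewrite /a le_min ge_min ler01 bk0 lexx.
have abk : a <= bk by rewrite /a ge_min lexx orbT.
have p01 : 0 <= p <= 1 by apply/andP; split; lra.
apply: le_trans (Pr_walk_step pw p01 lw xV a01 be0 _) _.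
  move=> u uV; have uP := IH _ _ (x |: (neg x |: Z)) (light_sub lw uV) (setD1_notin _ _).
  have : Pr w (fun F => walk true true k F u (V :\ u.1) (x |: (neg x |: Z))) <= bk + be.
    apply: le_trans uP _; rewrite lerD2l /be !ler_wpM2r ?ler_wpM2l ?ler_nat //; last first.
      by rewrite leq_add2r card_grow.
    by rewrite ltW // (lt_le_trans ltr01).
  rewrite /a minEle; case: ifP => _ // _.
  by apply: le_trans (Pr_le1 _ pw) _; rewrite lerDl.
have p02 : 0 <= p <= 2^-1 by rewrite p0.
have := survival_step el lam1 p02 a01 abk.
rewrite -el; move: (1 - (1 - p * a) ^+ (2 * n)) => s1 h1.
rewrite addrAC addrC; apply: lerD => //.
have -> : lam * be = k%:R * (#|Z| + 2 + 2 * k)%:R * p * lam ^+ k.+1.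
  by rewrite /be exprS; ring.
have lk1 : 1 <= lam ^+ k.+1 by rewrite exprn_ege1.
have e : (#|Z| + 2 * k.+1)%N = (#|Z| + 2 + 2 * k)%N by rewrite mulnS addnA.
rewrite e -[in leRHS]natr1 mulrDl mul1r !mulrDl addrC lerD2l.
apply: le_trans (_ : (#|Z| + 2 + 2 * k)%:R * p <= _).
  by rewrite ler_wpM2r // ler_nat -addnA leq_addr.
by rewrite ler_peMr // mulr_ge0.
Qed.

Lemma Pr_walk_hit k w p x V Z (lam : R) : is_prob w -> 0 <= p <= 2^-1 ->
  lam = (2 * n)%:R * p -> 1 <= lam -> light w p x V -> x.1 \notin V ->
  Pr w (fun F => walk false false k F x V Z) <= k%:R * #|Z|%:R * p * lam ^+ k.
Proof.
move=> pw /andP[p0 p2] el lam1; elim: k x V => [|k IH] x V lw xV.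
  by rewrite /= [Pr _ _]Ex_cst expr0 !mul0r.
have lk : 1 <= lam ^+ k by rewrite exprn_ege1.
have be0 : 0 <= k%:R * #|Z|%:R * p * lam ^+ k by rewrite !mulr_ge0 //; lra.
have p01 : 0 <= p <= 1 by apply/andP; split; lra.
have a01 : 0 <= (0 : R) <= 1 by rewrite lexx ler01.
apply: le_trans (Pr_walk_step pw p01 lw xV a01 be0 _) _.
  move=> u uV; rewrite add0r; apply: IH; first exact: light_sub lw uV.
  exact: setD1_notin.
rewrite mulr0 subr0 expr1n subrr addr0 -el exprS -natr1.
set K := k%:R; set z := #|Z|%:R.
have -> : (K + 1) * z * p * (lam * lam ^+ k) =
  z * p * lam ^+ k.+1 + lam * (K * z * p * lam ^+ k) by rewrite exprS; ring.
rewrite lerD2r ler_peMr ?exprn_ege1 // mulr_ge0 //; exact: ler0n.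
Qed.

(** First moment below criticality: at most (1 - eps)^j walks of length j are expected, each with
    |Z| + 2j targets. The geometric sums converge, so the bound is free of k. *)
Lemma Pr_walk_lasso k w p x V Z (eps : R) : is_prob w -> 0 <= p <= 1 ->
  (2 * n)%:R * p <= 1 - eps -> 0 < eps <= 1 -> light w p x V -> x.1 \notin V ->
  Pr w (fun F => walk false true k F x V Z) <= p * (#|Z|%:R / eps + 2 / eps ^+ 2).
Proof.
move=> pw p01 el /andP[e0 e1]; have [p0 p1] := andP p01.
have bd_ge0 (m : nat) : 0 <= p * (m%:R / eps + 2 / eps ^+ 2).
  rewrite mulr_ge0 // addr_ge0 // divr_ge0 ?ler0n //; first exact: ltW.
  by rewrite exprn_ge0 // ltW.
elim: k x V Z => [|k IH] x V Z lw xV.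
  by rewrite /= [Pr _ _]Ex_cst.
set be := p * ((#|Z| + 2)%:R / eps + 2 / eps ^+ 2).
have be0 : 0 <= be by exact: bd_ge0.
have a01 : 0 <= (0 : R) <= 1 by rewrite lexx ler01.
apply: le_trans (Pr_walk_step pw p01 lw xV a01 be0 _) _.
  move=> u uV; rewrite add0r; apply: le_trans (IH _ _ _ _ _) _.
  - exact: light_sub lw uV.
  - exact: setD1_notin.
  - rewrite /be ler_wpM2l // lerD2r ler_wpM2r ?invr_ge0 ?(ltW e0) // ler_nat.
    exact: card_grow.
rewrite mulr0 subr0 expr1n subrr addr0.
have : (2 * n)%:R * p * be <= (1 - eps) * be by rewrite ler_wpM2r.
suff : #|Z|%:R * p + (1 - eps) * be <= p * (#|Z|%:R / eps + 2 / eps ^+ 2) by lra.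
rewrite /be natrD; set z := #|Z|%:R.
have -> : p * (z / eps + 2 / eps ^+ 2) = z * p + (1 - eps) * (p * ((z + 2) / eps + 2 / eps ^+ 2))
    + p * 2.
  by field; rewrite gt_eqF.
by rewrite lerDl mulr_ge0.
Qed.

End WalkProbability.

(** * Contradictory literals and bicycles *)

Section Satisfiability.
Context {n : nat}.
Implicit Types (x y z u : literal n) (F T : formula n) (V S : {set 'I_n}).
Implicit Types (Z : {set literal n}) (c : clause n).

Definition spine F x : bool := connect (imp F) x (neg x).

Lemma connect_imp_mono F F' x y : F \subset F' ->
  connect (imp F) x y -> connect (imp F') x y.
Proof.
by move=> FF'; apply: connect_sub => u v uv; apply: connect1; exact: imp_mono uv.
Qed.

Lemma spine_mono x : increasing (spine^~ x).
Proof. by move=> F F' FF'; exact: connect_imp_mono. Qed.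

Lemma satisfiable_anti F F' : F \subset F' -> satisfiable F' -> satisfiable F.
Proof.
move=> /subsetP FF' /existsP[a /forallP h]; apply/existsP; exists a.
by apply/forallP => C; apply/implyP => /FF' CF; exact: (implyP (h C)).
Qed.

Lemma lit_true_neg (a : {ffun 'I_n -> bool}) x : lit_true a (neg x) = ~~ lit_true a x.
Proof. by rewrite /lit_true /=; case: (a _); case: x.2. Qed.

Lemma sat_imp (a : {ffun 'I_n -> bool}) F x y :
  [forall C in F, exists l in val C, lit_true a l] ->
  imp F x y -> lit_true a x -> lit_true a y.
Proof.
move=> /forallP sa /existsP[C /andP[CF /eqP e]] ax.
have /existsP[l /andP[]] := implyP (sa C) CF.
by rewrite e => /set2P[]-> //; rewrite lit_true_neg ax.
Qed.

Lemma sat_connect (a : {ffun 'I_n -> bool}) F x y :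
  [forall C in F, exists l in val C, lit_true a l] ->
  connect (imp F) x y -> lit_true a x -> lit_true a y.
Proof.
move=> sa /connectP[p]; elim: p x => [|z p IH] x /=; first by move=> _ ->.
by case/andP=> xz pz e /(sat_imp sa xz); apply: IH.
Qed.

(* Overwriting a satisfying assignment by the literals reachable from x keeps
   it satisfying, unless x leads to its own negation. *)
Lemma sat_add F x (C : clause n) : satisfiable F -> ~~ spine F x -> x \in val C ->
  satisfiable (C |: F).
Proof.
move=> /existsP[a sa] nx xC; pose r := connect (imp F) x.
pose a' := [ffun i => r (i, true) || ~~ r (i, false) && a i].
have r_cons l : r l -> r (neg l) -> False.
  move=> rl rnl; case/negP: nx; apply: connect_trans rl _.
  by rewrite -connect_neg negK.
have a'1 l : r l -> lit_true a' l.
  case: l => i [] h; rewrite /lit_true ffunE /= ?h // /neg.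
  by case: (boolP (r (i, true))) => // h'; case: (r_cons _ h').
have a'0 l : ~~ r l -> ~~ r (neg l) -> lit_true a' l = lit_true a l.
  by case: l => i [] /negbTE h1 /negbTE h2; rewrite /lit_true ffunE /=; rewrite /neg /= in h2; rewrite h1 h2.
apply/existsP; exists a'; apply/forallP => D; apply/implyP => /setU1P[->|DF].
  by apply/existsP; exists x; rewrite xC a'1 //; exact: connect0.
have [y [z [yz e]]] := clause_var D.
have yz' : imp F (neg y) z by apply/existsP; exists D; rewrite DF e negK eqxx.
have zy' : imp F (neg z) y by apply/existsP; exists D; rewrite DF e negK setUC eqxx.
have wit l : l \in val D -> lit_true a' l -> [exists l in val D, lit_true a' l].
  by move=> lD al; apply/existsP; exists l; rewrite lD.
have yD : y \in val D by rewrite e set21.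
have zD : z \in val D by rewrite e set22.
have [ry|ry] := boolP (r y); first exact: wit yD (a'1 _ ry).
have [rz|rz] := boolP (r z); first exact: wit zD (a'1 _ rz).
have [rny|rny] := boolP (r (neg y)).
  by case/negP: rz; apply: connect_trans rny (connect1 yz').
have [rnz|rnz] := boolP (r (neg z)).
  by case/negP: ry; apply: connect_trans rnz (connect1 zy').
have /existsP[l /andP[lD al]] := implyP (forallP sa D) DF.
apply: (wit l lD); move: lD al; rewrite e => /set2P[]->; by rewrite a'0.
Qed.

Lemma sat_pivotal F (C : clause n) x y : val C = [set x; y] -> satisfiable F ->
  ~~ satisfiable (C |: F) -> spine F x && spine F y.
Proof.
move=> e sF; apply: contraR => /nandP[]/sat_add h; apply: h => //;
  by rewrite e ?set21 ?set22.
Qed.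

(** Delete clauses until one deletion restores satisfiability. The last clause, on x and y, is then
    pivotal: both literals are in the spine of the rest, and it closes the chain from [neg x] to y
    to [neg y] to x. *)
Lemma unsat_contradiction F : ~~ satisfiable F ->
  exists2 x, connect (imp F) x (neg x) & connect (imp F) (neg x) x.
Proof.
have [m] := ubnP #|F|; elim: m F => // m IH F; rewrite ltnS => Fm uF.
have [F0|[C CF]] := set_0Vmem F.
  case/negP: uF; apply/existsP; exists [ffun=> true]; apply/forallP => C.
  by rewrite F0 inE.
have FC : F :\ C \subset F by exact: subD1set.
have [sF|uF'] := boolP (satisfiable (F :\ C)); last first.
  have [|x h1 h2] := IH (F :\ C) _ uF'.
    by apply: leq_trans Fm; rewrite [X in (_ < X)%N](cardsD1 C) CF.
  by exists x; apply: connect_imp_mono FC _.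
have [x [y [xy e]]] := clause_var C.
have /andP[sx sy] : spine (F :\ C) x && spine (F :\ C) y.
  by apply: (sat_pivotal e sF); rewrite setD1K.
have nxy : imp F (neg x) y by apply/existsP; exists C; rewrite CF e negK eqxx.
have nyx : imp F (neg y) x by apply/existsP; exists C; rewrite CF e negK setUC eqxx.
exists x; first exact: connect_imp_mono FC sx.
apply: connect_trans (connect1 nxy) _.
by apply: connect_trans (connect_imp_mono FC sy) (connect1 nyx).
Qed.

Lemma non_uniq_map (A : eqType) (B : eqType) (f : A -> B) (s : seq A) :
  ~~ uniq (map f s) ->
  exists s1 a s2 b s3, s = s1 ++ a :: s2 ++ b :: s3 /\ f a = f b.
Proof.
elim: s => //= a s IH; rewrite negb_and negbK => /orP[/mapP[b bs e]|/IH].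
  by case/splitPr: bs => s2 s3; exists [::], a, s2, b, s3.
by move=> [s1 [a' [s2 [b [s3 [-> e]]]]]]; exists (a :: s1), a', s2, b, s3.
Qed.

(** Descent on the length of the path from x to [neg x]: a repeated literal marks a loop to cut out,
    while opposite literals a and [neg a] on the path give a shorter instance starting from a. *)
Lemma contradiction_lasso F x : connect (imp F) x (neg x) -> connect (imp F) (neg x) x ->
  exists z q, [/\ path (imp F) z q, last z q = neg z, uniq (map fst q) &
    connect (imp F) (neg z) z].
Proof.
move=> /connectP[p]; have [m] := ubnP (size p).
elim: m x p => // m IH x p; rewrite ltnS => pm pp e nx.
have [up|/non_uniq_map[s1 [a [s2 [b [s3 [ep eab]]]]]]] := boolP (uniq (map fst p)).
  by exists x, p.
move: pp e pm; rewrite ep !(cat_path, last_cat, size_cat) /= !(cat_path, last_cat, size_cat) /=.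
case/and5P=> p1 la p2 lb p3 e sz.
have [ab|ab] := same_var eab.
  apply: (IH x (s1 ++ a :: s3)) => //.
  - by move: sz; rewrite size_cat /=; move: (size s1) (size s2) (size s3) => *; lia.
  - by rewrite cat_path /= p1 la /= ab.
  - by rewrite last_cat /= ab.
have nab : neg a = b by rewrite ab negK.
apply: (IH a (rcons s2 (neg a))).
- by move: sz; rewrite size_rcons; move: (size s1) (size s2) (size s3) => *; lia.
- by rewrite rcons_path p2 nab.
- by rewrite last_rcons.
have ca : connect (imp F) x a.
  apply/connectP; exists (rcons s1 a); first by rewrite rcons_path p1.
  by rewrite last_rcons.
apply: connect_trans (connect_trans _ nx) ca.
by apply/connectP; exists s3; rewrite ?nab.
Qed.

(* A bicycle through s: a path of new variables from s containing a literal t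
   with the clause (t or s), and whose last step hits a visited variable. *)
Fixpoint bicycle k F s x V Z : bool :=
  if k is k'.+1 then
    (imp F (neg x) s && walk false true k' F x V Z) ||
    has (fun u => [&& u.1 \in V, imp F x u &
      bicycle k' F s u (V :\ u.1) (x |: (neg x |: Z))]) (enum {: literal n})
  else false.

Lemma bicycle_local k F F' s x V Z :
  (forall c u, (u == x) || (u.1 \in V) ->
     neg u \in val c \/ (s \in val c /\ u \in val c) -> (c \in F) = (c \in F')) ->
  bicycle k F s x V Z = bicycle k F' s x V Z.
Proof.
elim: k x V Z => //= k IH x V Z h.
have ix z : imp F x z = imp F' x z.
  by apply: imp_local => c xc; apply: (h c x); rewrite ?eqxx //; left.
congr (_ || _).
  congr (_ && _); last first.
    by apply: walk_local => c u hu uc; apply: (h c u) => //; left.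
  apply: eq_existsb => c; case: eqP => [e|]; last by rewrite !andbF.
  rewrite (h c x) ?eqxx //; right; rewrite e negK !inE !eqxx ?orbT //.
apply: eq_has => u; rewrite ix; case uV: (u.1 \in V) => //=.
congr (_ && _); apply: IH => c u' /orP[/eqP->|].
  by apply: h; rewrite uV orbT.
by rewrite !inE => /andP[_ u'V]; apply: h; rewrite u'V orbT.
Qed.

Lemma path_bicycle k F s x V Z q r :
  path (imp F) x q -> uniq (map fst q) -> (forall l, l \in q -> l.1 \in V) ->
  x.1 \notin V -> imp F (neg (last x q)) s ->
  path (imp F) (last x q) r -> last (last x q) r = neg (last x q) ->
  (forall l : literal n, l.1 \notin V -> l.1 != x.1 -> l \in Z) ->
  (#|V|.+1 < k)%N -> bicycle k F s x V Z.
Proof.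
elim: k x V Z q => // k IH x V Z [|u q] /=.
  move=> _ _ _ xV xs pr er hZ kV; apply/orP; left; rewrite xs /=.
  apply: (path_walk pr) => //; first by apply: contraNneq (neg_neq x) => r0; rewrite -er r0.
  by rewrite er.
move=> /andP[xu pu] /andP[uq uuq] qV xV ls pr er hZ kV.
have uV : u.1 \in V by apply: qV; rewrite mem_head.
apply/orP; right; apply/hasP; exists u; rewrite ?mem_enum //= uV xu /=.
apply: (IH _ _ _ q) => //.
- move=> l lq; rewrite !inE qV ?inE ?lq ?orbT // andbT.
  by apply: contraNneq uq => <-; apply: map_f.
- exact: setD1_notin.
- move=> l; rewrite !inE => /nandP[/negbNE ->//|lV'] _.
  have [/same_var[]->|/(hZ _ lV')->] := eqVneq l.1 x.1; by rewrite ?eqxx ?orbT.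
- by move: kV; rewrite (cardsD1 u.1 V) uV.
Qed.

Lemma unsat_bicycle F : ~~ satisfiable F ->
  [exists s : literal n, bicycle n.+1 F s s [set~ s.1] set0].
Proof.
case/unsat_contradiction => x h1 h2.
have [z [[|s q] /= [pq lq uq nz]]] := contradiction_lasso h1 h2.
  by have := neg_neq z; rewrite -{1}lq eqxx.
have [zs pq'] := andP pq; have [us uq'] := andP uq.
have /connectP[r pr er] := nz.
suff B : bicycle n.+1 F s s [set~ s.1] set0 by apply/existsP; exists s.
(* The literal t of the bicycle is [neg z], the end of q: its clause with s is the implication from
   z to s. The path r leads from [neg z] back to z, so it has to hit a visited variable. *)
apply: (@path_bicycle n.+1 F s s _ set0 q r) => //.
- move=> l lq'; rewrite !inE; apply: contraNneq us => <-; exact: map_f.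
- by rewrite !inE eqxx.
- by rewrite lq negK.
- by rewrite lq.
- by rewrite lq negK -er.
- by move=> l; rewrite !inE => /negbNE->.
- by rewrite cardsC1 card_ord; have := ltn_ord s.1; lia.
Qed.

End Satisfiability.

(** * First moment of bicycles *)

Section SatProbability.
Context {R : realFieldType} {n : nat}.
Implicit Types (x y z u : literal n) (F T : formula n) (V S : {set 'I_n}).
Implicit Types (Z : {set literal n}) (c : clause n) (w : clause n -> R) (p : R).

Lemma light_all w p x V : (forall c, w c <= p) -> light w p x V.
Proof. by move=> h c u _ _; exact: h. Qed.

(** The recursion of [Pr_walk_lasso] again: the clause with s costs a factor p, and the choice of
    its place on the path a factor 1 / eps. The condition [s != neg x] prevents the clause of a step
    from also being the clause joining s to a later literal. *)
Lemma Pr_bicycle k w p s x V Z (eps : R) : is_prob w -> 0 <= p <= 1 ->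
  (2 * n)%:R * p <= 1 - eps -> 0 < eps <= 1 -> (forall c, w c <= p) ->
  x.1 \notin V -> s.1 \notin V -> s != neg x ->
  Pr w (fun F => bicycle k F s x V Z) <= p ^+ 2 * (#|Z|%:R / eps ^+ 2 + 4 / eps ^+ 3).
Proof.
move=> pw p01 el e01 wp; have [p0 p1] := andP p01; have [e0 e1] := andP e01.
have bd_ge0 (m : nat) : 0 <= p ^+ 2 * (m%:R / eps ^+ 2 + 4 / eps ^+ 3).
  by rewrite mulr_ge0 ?exprn_ge0 // addr_ge0 // divr_ge0 ?ler0n // exprn_ge0 // ltW.
elim: k x V Z => [|k IH] x V Z xV sV snx; first by rewrite /= [Pr _ _]Ex_cst.
apply: le_trans (Pr_or _ _ pw) _.
have close : Pr w (fun F => imp F (neg x) s && walk false true k F x V Z) <=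
    p * (p * (#|Z|%:R / eps + 2 / eps ^+ 2)).
  have W := Pr_walk_lasso k Z pw p01 el e01 (light_all (x := x) (V := V) wp) xV.
  have [xs|xs] := eqVneq x.1 s.1.
    rewrite (@eq_Pr _ _ _ _ pred0) ?[Pr _ _]Ex_cst => [|F].
      by rewrite mulr_ge0 //; apply: le_trans W; exact: Pr_ge0.
    by apply/negbTE/negP => /andP[/imp_var]; rewrite /= xs eqxx.
  have [c ec ic] := imp_clause (xs : (neg x).1 != s.1).
  rewrite (@eq_Pr _ _ _ _ (fun F => (c \in F) && walk false true k F x V Z)); last first.
    by move=> F; rewrite ic.
  rewrite Pr_mem_indep => [|F].
    by rewrite ler_pM ?Pr_ge0 //; case/andP: (pw c).
  apply: walk_local => c' u' hu' nu'; rewrite !inE.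
  case: eqP => // e; move: nu'; rewrite e ec negK => /set2P nu'.
  case/orP: hu' => [/eqP u'x|u'V]; case: nu' => nu'.
  - by have := neg_neq x; rewrite -{1}u'x nu' eqxx.
  - by case/eqP: xs; rewrite -nu' u'x.
  - by case/negP: xV; rewrite -nu'.
  - by case/negP: sV; rewrite -nu'.
have cont : Pr w (fun F => has (fun u => [&& u.1 \in V, imp F x u &
      bicycle k F s u (V :\ u.1) (x |: (neg x |: Z))]) (enum {: literal n})) <=
    (1 - eps) * (p ^+ 2 * ((#|Z| + 2)%:R / eps ^+ 2 + 4 / eps ^+ 3)).
  set Z' := x |: _.
  apply: le_trans (_ : (2 * n)%:R * p * (p ^+ 2 * ((#|Z| + 2)%:R / eps ^+ 2 + 4 / eps ^+ 3)) <= _);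
    last by rewrite ler_wpM2r.
  have lits : (2 * n)%N = #|{: literal n}| by rewrite card_prod card_ord card_bool mulnC.
  rewrite -mulrA mulr_natl lits -sumr_const.
  apply: le_trans (le_Pr pw _) (le_trans (Pr_exists_le predT (fun u F => [&& u.1 \in V,
      imp F x u & bicycle k F s u (V :\ u.1) Z']) pw) (ler_sum _ _)).
    by move=> F /hasP[u _ h]; apply/existsP; exists u.
  move=> u _; have [uV|uV] := boolP (u.1 \in V); last first.
    by rewrite [Pr _ _]Ex_cst mulr_ge0.
  have xu : x.1 != u.1 by apply: contraNneq xV => ->.
  have [c ec ic] := imp_clause xu.
  rewrite (@eq_Pr _ _ _ _ (fun F => (c \in F) && bicycle k F s u (V :\ u.1) Z')); last first.
    by move=> F; rewrite ic.
  rewrite Pr_mem_indep => [|F].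
    rewrite ler_pM ?Pr_ge0 //; first by case/andP: (pw c).
    apply: le_trans (IH _ _ _ _ _ _) _.
    - exact: setD1_notin.
    - by rewrite !inE (negbTE sV) andbF.
    - by apply: contraNneq sV => ->.
    - rewrite ler_wpM2l ?exprn_ge0 // lerD2r ler_wpM2r ?invr_ge0 ?exprn_ge0 ?(ltW e0) //.
      by rewrite ler_nat card_grow.
  apply: bicycle_local => c' u' hu' h; rewrite !inE.
  case: eqP => // e; move: h; rewrite e ec => -[].
    move=> /set2P[/neg_inj ee|ee].
      by case/negP: xV; rewrite -ee; case/orP: hu' => [/eqP->//|]; rewrite !inE => /andP[].
    case/orP: hu' => [/eqP u'u|].
      by have := neg_neq u; rewrite -{1}u'u ee eqxx.
    by rewrite !inE -ee eqxx.
  move=> [/set2P[ee|ee] _]; first by rewrite ee eqxx in snx.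
  by rewrite -ee (negbTE sV) in uV.
apply: le_trans (lerD close cont) _.
rewrite natrD; set z := #|Z|%:R.
have -> : p ^+ 2 * (z / eps ^+ 2 + 4 / eps ^+ 3) =
   p * (p * (z / eps + 2 / eps ^+ 2)) + (1 - eps) * (p ^+ 2 * ((z + 2) / eps ^+ 2 + 4 / eps ^+ 3)) + p ^+ 2 * (2 / eps).
  by field; rewrite gt_eqF.
by rewrite lerDl mulr_ge0 ?exprn_ge0 // divr_ge0 // ltW.
Qed.
End SatProbability.

(** * Lower bound on the probability of satisfiability *)

Section LowerBound.
Context {R : realFieldType} {n : nat}.
Implicit Types (x y z u : literal n) (F T : formula n) (V S : {set 'I_n}).
Implicit Types (Z : {set literal n}) (c : clause n) (w : clause n -> R) (p : R).

Lemma Pr_unsat_subcritical w p (eps : R) : is_prob w -> 0 <= p <= 1 ->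
  (2 * n)%:R * p <= 1 - eps -> 0 < eps <= 1 -> (forall c, w c <= p) ->
  Pr w (predC (@satisfiable n)) <= (2 * n)%:R * (p ^+ 2 * (4 / eps ^+ 3)).
Proof.
move=> pw p01 el e01 wp.
have lits : (2 * n)%N = #|{: literal n}| by rewrite card_prod card_ord card_bool mulnC.
rewrite mulr_natl lits -sumr_const.
apply: le_trans (le_Pr pw _) (le_trans (Pr_exists_le predT (fun s F =>
   bicycle n.+1 F s s [set~ s.1] set0) pw) (ler_sum _ _)).
  by move=> F /unsat_bicycle.
move=> s _; have := @Pr_bicycle R n n.+1 w p s s [set~ s.1] set0 eps pw p01 el e01 wp.
rewrite cards0 mul0r add0r; apply; rewrite ?inE ?eqxx //.
by rewrite eq_sym neg_neq.
Qed.

Lemma sat_mono_neg : mono (fun F => - (satisfiable F)%:R : R).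
Proof.
move=> F F' /satisfiable_anti h; rewrite lerN2 ler_nat.
by case: (satisfiable F') h => // ->.
Qed.

(** The bound of [Pr_walk_survive] for |Z| = 2 (k + 1), the number of literals over a witness with k
    + 1 variables; hence 4 k + 2. *)
Definition survival_bound (k : nat) p : R :=
  4 * ((2 * n)%:R * p) ^+ k / (k%:R + 4) +
  k%:R * (4 * k + 2)%:R * p * ((2 * n)%:R * p) ^+ k.

(* Reveal a smallest witness T that x survives: given T, the walk from y either
   survives outside T or hits one of the O(k) variables of T. *)
Lemma Pr_spine2 (k : nat) w p x y : is_prob w -> 0 <= p <= 2^-1 ->
  1 <= (2 * n)%:R * p -> (forall c, w c <= p) -> x.1 != y.1 ->
  Pr w (fun F => spine F x && spine F y) <=
    k%:R * 2 * p * ((2 * n)%:R * p) ^+ k + survival_bound k p ^+ 2.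
Proof.
move=> pw p02 lam1 wp xy.
pose Vx : {set 'I_n} := [set~ x.1]; pose Vxy := Vx :\ y.1.
have xVx : x.1 \notin Vx by rewrite !inE eqxx.
have xVxy : x.1 \notin Vxy by rewrite !inE eqxx andbF.
pose A F := walk true true k F x Vxy set0.
pose H F := walk false false k F x Vx [set (y.1, true); (y.1, false)].
(* The witness for x must leave the variable of y untouched; H takes care of the walks that run into
   it. *)
have sAH F : spine F x && spine F y -> H F || (A F && spine F y).
  case/andP=> sx sy; rewrite sy andbT orbC; apply: walk_avoid.
  by apply: connect_walk sx xVx _ => l; rewrite !inE => /negbNE->.
apply: le_trans (le_Pr pw sAH) (le_trans (Pr_or _ _ pw) _); apply: lerD.
  have := Pr_walk_hit k [set (y.1, true); (y.1, false)] pw p02 erefl lam1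
    (light_all (x := x) (V := Vx) wp) xVx.
  by rewrite cards2 xpair_eqE eqxx.
have p0 : 0 <= p by case/andP: p02.
have lamk : 0 <= ((2 * n)%:R * p) ^+ k by rewrite exprn_ge0 // mulr_ge0.
have PA : Pr w A <= survival_bound k p.
  have lw : light w p x Vxy := light_all wp.
  apply: le_trans (Pr_walk_survive k set0 pw p02 erefl lam1 lw xVxy) _.
  rewrite lerD2l !ler_wpM2r ?ler_wpM2l ?ler_nat //.
  by rewrite cards0; lia.
pose small T := [exists S : {set 'I_n}, [&& (#|S| <= k.+1)%N, y.1 \notin S &
   [forall c in T, forall l in val c, l.1 \in S]]] && A T.
have hasA F : has (fun T => T \subset F) (enum small) = A F.
  apply/hasP/idP => [[T] |AF].
    rewrite mem_enum => /andP[_ AT] TF; exact: walk_mono AT.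
  have [S [T [SV Sk TF hT AT]]] := walk_support AF.
  exists T => //; rewrite mem_enum; apply/andP; split => //.
  apply/existsP; exists (x.1 |: S); apply/and3P; split.
  - by rewrite cardsU1 -(add1n k) leq_add ?leq_b1.
  - rewrite !inE negb_or eq_sym xy; apply/negP => /(subsetP SV).
    by rewrite !inE eqxx.
  - apply/forallP => c; apply/implyP => cT; apply/forallP => l; apply/implyP => lc.
    case/orP: (hT _ _ cT lc) => // /existsP[z]; by rewrite inE.
have eA : Pr w (fun F => A F && spine F y) =
    Pr w (fun F => has (fun T => T \subset F) (enum small) && spine F y).
  by apply: eq_Pr => F; rewrite hasA.
rewrite eA expr2; apply: le_trans (Pr_witness (beta := survival_bound k p) pw (@spine_mono n y) _) _.
  move=> T; rewrite mem_enum => /andP[/existsP[S /and3P[Sk yS /forallP hT]] _].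
  pose V := [set~ y.1] :\: S; pose Z := [set l : literal n | l.1 \in S].
  have yV : y.1 \notin V by rewrite !inE eqxx andbF.
  have cZ : (#|Z| <= 2 * k.+1)%N.
    have -> : Z = finset.setX S setT by apply/setP => l; rewrite !inE andbT.
    by rewrite cardsX cardsT card_bool mulnC leq_mul2l Sk orbT.
  (* The clauses of T now have probability 1, but all their variables lie in S, so no step from y or
     from a variable of V reads them. *)
  have lw : light (force w T) p y V.
    move=> c u hu nu; rewrite /force; case: ifP => [cT|_]; last exact: wp.
    have uS : u.1 \in S.
      by have /forallP/(_ (neg u))/implyP := implyP (hT c) cT; apply.
    by case/orP: hu => [/eqP uy|]; [rewrite uy (negbTE yS) in uS|rewrite !inE uS].
  have sw F : spine F y -> walk true true k F y V Z.
    move=> sy; apply: connect_walk sy yV _ => l.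
    by rewrite !inE negb_and !negbK => /orP[->//|->].
  apply: le_trans (le_Pr (force_prob T pw) sw) _.
  apply: le_trans (Pr_walk_survive k Z (force_prob T pw) p02 erefl lam1 lw yV) _.
  rewrite lerD2l !ler_wpM2r ?ler_wpM2l ?ler_nat //.
  by move: cZ; move: #|Z| => m; clear; lia.
rewrite (eq_Pr _ hasA) ler_wpM2l //.
by apply: le_trans PA; exact: Pr_ge0.
Qed.

(* Adding a clause to a satisfiable formula makes it unsatisfiable only if both
   of its literals are in the spine; satisfiability being decreasing, it can only
   lower the probability of that. *)
Lemma Pr_sat_upd w c (b p pi : R) : is_prob w -> (forall c, w c <= p) -> p < 1 ->
  w c <= b <= p ->
  (forall w' x y, is_prob w' -> (forall c, w' c <= p) -> x.1 != y.1 ->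
     Pr w' (fun F => spine F x && spine F y) <= pi) ->
  (1 - (b - w c) * (pi / (1 - p))) * Pr w (@satisfiable n) <=
    Pr (upd w c b) (@satisfiable n).
Proof.
move=> pw wp p1 /andP[wb bp] hpi.
have [x [y [xy ec]]] := clause_var c.
have pw0 := upd_prob0 c pw; have p0 : 0 <= p by apply: le_trans (wp c); case/andP: (pw c).
pose a0 := Pr (upd w c 0) (@satisfiable n).
pose a1 := Pr (upd w c 1) (@satisfiable n).
have a00 : 0 <= a0 := Pr_ge0 _ pw0.
have ediff : a0 - a1 = Ex (upd w c 0) (fun F => (satisfiable F)%:R - (satisfiable (c |: F))%:R).
  by rewrite ExB /a0 /a1 /Pr Ex_upd1 (Ex_upd_set w (fun F => (satisfiable F)%:R) c 1 0).
have hpi0 : Pr (upd w c 0) (fun F => spine F x && spine F y) <= pi.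
  apply: hpi => // c'; rewrite /upd; case: eqP => // _; exact: wp.
have d1 : a0 - a1 <= pi * a0.
  rewrite ediff; apply: le_trans (le_Ex (g := fun F => (spine F x && spine F y)%:R * (satisfiable F)%:R) pw0 _) _.
    move=> F; case sF : (satisfiable F); last first.
      case sF' : (satisfiable (c |: F)); rewrite ?subrr ?mulr0 //.
      by rewrite (satisfiable_anti (subsetUr [set c] F) sF') in sF.
    case sF' : (satisfiable (c |: F)); rewrite ?subrr ?mulr1 ?ler0n //.
    by rewrite (sat_pivotal ec sF) ?sF' // subr0.
  apply: le_trans (Harris_anti pw0 _ sat_mono_neg) _.
    by apply: increasing_mono => F F' FF' /andP[sx sy]; rewrite !(spine_mono FF').
  by rewrite ler_wpM2r.
have ew : Pr w (@satisfiable n) = a0 - w c * (a0 - a1).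
  by rewrite /Pr (Ex_split _ _ c) -/(Pr _ _) -/(Pr _ _) -/a1 -/a0; ring.
have eb : Pr (upd w c b) (@satisfiable n) = a0 - b * (a0 - a1).
  rewrite /Pr (Ex_split _ _ c).
  have uu d : Ex (upd (upd w c b) c d) (fun F => (satisfiable F)%:R) =
      Pr (upd w c d) (@satisfiable n).
    by apply: eq_Ex => // i; rewrite /upd; case: eqP.
  by rewrite !uu -/a1 -/a0 /upd eqxx; ring.
rewrite ew eb.
have a10 : 0 <= a1 by apply: Pr_ge0; exact: upd_prob1.
have w0 : 0 <= w c by case/andP: (pw c).
have wcp := wp c.
(* The drop is measured against satisfiability without c, while the claim compares with [Pr w];
   since c is absent with probability at least 1 - p, the change costs the factor 1 / (1 - p). *)
have ha0 : a0 * (1 - p) <= a0 - w c * (a0 - a1) by nra.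
have pi0 : 0 <= pi by apply: le_trans hpi0; exact: Pr_ge0.
have q0 : 0 < 1 - p by lra.
have h2 : pi * a0 <= pi / (1 - p) * (a0 - w c * (a0 - a1)).
  by rewrite mulrAC ler_pdivlMr // -mulrA ler_wpM2l.
rewrite mulrBl mul1r.
have h3 : (b - w c) * (a0 - a1) <= (b - w c) * (pi / (1 - p) * (a0 - w c * (a0 - a1))).
  by rewrite ler_wpM2l ?subr_ge0 //; lra.
rewrite -mulrA; lra.
Qed.

(** [Pr_sat_upd] is iterated along an enumeration of the clauses; the intermediate measures mix p0
    and p, so pi has to serve every measure bounded by p. *)
Lemma Pr_sat_ratio (p0 p pi : R) : 0 <= p0 <= p -> p < 1 ->
  (p - p0) * (pi / (1 - p)) <= 1 ->
  (forall w' x y, is_prob w' -> (forall c, w' c <= p) -> x.1 != y.1 ->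
     Pr w' (fun F => spine F x && spine F y) <= pi) -> 0 <= pi ->
  (1 - (p - p0) * (pi / (1 - p))) ^+ #|{: clause n}| * Pr (fun=> p0) (@satisfiable n) <=
    Pr (fun=> p) (@satisfiable n).
Proof.
move=> /andP[p00 p0p] p1 d1 hpi pi0.
set d := (p - p0) * _ in d1 *.
pose w (s : seq (clause n)) c := if c \in s then p else p0.
have pw s : is_prob (w s) by move=> c; rewrite /w; case: ifP => _; apply/andP; split; lra.
have wp s c : w s c <= p by rewrite /w; case: ifP.
have d0 : 0 <= d by rewrite mulr_ge0 ?divr_ge0 //; lra.
have main s : (1 - d) ^+ size s * Pr (fun=> p0) (@satisfiable n) <= Pr (w s) (@satisfiable n).
  elim: s => [|c s IH].
    by rewrite expr0 mul1r lexx.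
  have [cs|cs] := boolP (c \in s).
    have -> : Pr (w (c :: s)) (@satisfiable n) = Pr (w s) (@satisfiable n).
      by apply: eq_Ex => // i; rewrite /w inE; case: eqP => // ->; rewrite cs.
    apply: le_trans IH; rewrite exprS -mulrA ler_piMl ?mulr_ge0 ?exprn_ge0 ?Pr_ge0 //; try lra.
    by move=> i; apply/andP; split; lra.
  have -> : Pr (w (c :: s)) (@satisfiable n) = Pr (upd (w s) c p) (@satisfiable n).
    by apply: eq_Ex => // i; rewrite /w /upd inE; case: eqP.
  have wc : w s c = p0 by rewrite /w (negbTE cs).
  apply: le_trans (Pr_sat_upd (c := c) (b := p) (pw s) (wp s) p1 _ hpi).
    by rewrite wc -/d exprS -mulrA ler_wpM2l // subr_ge0.
  by rewrite wc p0p lexx.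
rewrite cardE; apply: le_trans (main _) _.
rewrite le_eqVlt; apply/orP; left; apply/eqP; apply: eq_Ex => // i.
by rewrite /w mem_enum.
Qed.

End LowerBound.

(** * Depth-first search on a random formula *)

Section Adaptive.
Context {R : realFieldType} {I : finType} {S : Type}.
Variables (q : S -> option I) (nxt : S -> bool -> S).

Fixpoint run (k : nat) (st : S) (F : {set I}) : S :=
  if k is k'.+1 then run k' (nxt st (if q st is Some c then c \in F else false)) F
  else st.

(** Optional stopping for the supermartingale Psi. Revealing c turns w into [upd w c 1] or
    [upd w c 0], so Inv ties the state to the conditional measure. The reward g may still depend on
    unrevealed clauses, which lets a second search follow the first. *)
Lemma Ex_adaptive (Inv : S -> (I -> R) -> Prop) (Psi : S -> R) (g : S -> {set I} -> R) :
  (forall st w, is_prob w -> Inv st w -> Ex w (g st) <= Psi st) ->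
  (forall st w, is_prob w -> Inv st w -> q st = None ->
     Inv (nxt st false) w /\ Psi (nxt st false) <= Psi st) ->
  (forall st w c, is_prob w -> Inv st w -> q st = Some c ->
     [/\ Inv (nxt st true) (upd w c 1), Inv (nxt st false) (upd w c 0) &
      w c * Psi (nxt st true) + (1 - w c) * Psi (nxt st false) <= Psi st]) ->
  forall k st w, is_prob w -> Inv st w ->
    Ex w (fun F => g (run k st F) F) <= Psi st.
Proof.
move=> hg hN hS; elim=> [|k IH] st w pw iw; first exact: hg.
rewrite /=; case qst : (q st) => [c|]; last first.
  by have [iw' le] := hN _ _ pw iw qst; apply: le_trans (IH _ _ pw iw') le.
have [i1 i0 le] := hS _ _ _ pw iw qst.
rewrite (Ex_split _ _ c).
set h := fun F => _.
have -> : Ex (upd w c 1) h = Ex (upd w c 1) (fun F => g (run k (nxt st true) F) F).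
  by rewrite Ex_upd1 [RHS]Ex_upd1; apply: eq_Ex => // F; rewrite /h setU11.
have -> : Ex (upd w c 0) h = Ex (upd w c 0) (fun F => g (run k (nxt st false) F) F).
  by rewrite Ex_upd0 [RHS]Ex_upd0; apply: eq_Ex => // F; rewrite /h setD11.
apply: le_trans le; have /andP[w0 w1] := pw c.
apply: lerD; apply: ler_wpM2l; rewrite ?subr_ge0 //.
  by apply: IH => //; exact: upd_prob1.
by apply: IH => //; exact: upd_prob0.
Qed.

End Adaptive.

Section Search.
Context {R : realFieldType} {n : nat}.
Implicit Types (x y z u v r a : literal n) (F : formula n) (tl U : seq (literal n)).
Implicit Types (c : clause n) (Q : {set clause n}).

(* State of the depth-first search: the literals found so far, latest first;
   the stack, top first; the clauses queried so far. *)
Definition dfs_state := (seq (literal n) * seq (literal n) * {set clause n})%type.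
Implicit Types (st : dfs_state).

Variables (V : {set 'I_n}) (stop : pred dfs_state).

Definition candidate st v : option (literal n * clause n) :=
  [pick uc : literal n * clause n | [&& uc.1.1 \in V, uc.1.1 \notin map fst st.1.1,
     uc.2 \notin st.2 & val uc.2 == [set neg v; uc.1]]].

Definition query st : option (literal n * clause n) :=
  if st.1.2 is v :: _ then candidate st v else None.

Definition dfs_q st : option (clause n) :=
  if stop st then None else omap snd (query st).

Definition dfs_next st (b : bool) : dfs_state :=
  if stop st then st else
  if query st is Some uc then
    (if b then (uc.1 :: st.1.1, uc.1 :: st.1.2) else (st.1.1, st.1.2), uc.2 |: st.2)
  else (st.1.1, behead st.1.2, st.2).

Definition dfs := run dfs_q dfs_next.

Lemma queryP st uc : query st = Some uc ->
  exists v U, [/\ st.1.2 = v :: U, uc.1.1 \in V, uc.1.1 \notin map fst st.1.1,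
     uc.2 \notin st.2 & val uc.2 = [set neg v; uc.1]].
Proof.
rewrite /query; case: st => [[tl [//|v U]] Q] /=; rewrite /candidate.
case: pickP => // uc' /and4P[h1 h2 h3 /eqP h4] [<-].
by exists v, U.
Qed.

Lemma queryN st v U u c : query st = None -> st.1.2 = v :: U ->
  u.1 \in V -> u.1 \notin map fst st.1.1 -> val c = [set neg v; u] -> c \in st.2.
Proof.
rewrite /query; case: st => [[tl [//|v' U']] Q] /=; rewrite /candidate.
case: pickP => // h _ [ev _] uV utl ec; have := h (u, c) => /=.
by rewrite ev uV utl ec eqxx andbT; move/negbFE.
Qed.

Variables (U0 : seq (literal n)).

(* The part of the invariant that does not depend on the formula. *)
Record dfs_inv st : Prop := DfsInv {
  inv_uniq : uniq (map fst st.1.1);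
  inv_U : uniq st.1.2;
  inv_tl : exists2 s, st.1.1 = s ++ U0 & all (fun l => l.1 \in V) s;
  inv_stack : exists X j, [/\ st.1.2 = X ++ drop j U0, all (fun l => l.1 \in V) X &
                             {subset X <= st.1.1}];
  inv_queried : forall c, c \in st.2 -> exists2 v, v \in st.1.1 & neg v \in val c;
  inv_done : forall v u c, v \in st.1.1 -> v \notin st.1.2 -> u.1 \in V ->
      u.1 \notin map fst st.1.1 -> val c = [set neg v; u] -> c \in st.2 }.

Hypothesis U0_uniq : uniq (map fst U0).

Lemma inv_sub st : dfs_inv st -> {subset st.1.2 <= st.1.1}.
Proof.
case=> _ _ [s -> _] [X [j [-> _ XU]]] _ _ l; rewrite mem_cat => /orP[/XU//|].
by move/mem_drop => lU; rewrite mem_cat lU orbT.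
Qed.

Lemma dfs_inv_init : dfs_inv (U0, U0, set0).
Proof.
split => //=; first exact: map_uniq U0_uniq.
- by exists [::].
- by exists [::], 0%N; rewrite drop0.
- by move=> c; rewrite inE.
- by move=> v u c ->.
Qed.

Lemma dfs_inv_next st b : dfs_inv st -> dfs_inv (dfs_next st b).
Proof.
move=> ist; rewrite /dfs_next; case: ifP => // _.
case qst : (query st) => [[u c]|]; last first.
  case: (ist) => iu iU it [X [j [eX XV Xt]]] iq idone.
  have qN := queryN qst.
  case: st {ist} qst iu iU it eX Xt iq idone qN => [[tl U] Q] /= qst iu iU it eX Xt iq idone qN.
  split => //=; first by case: (U) iU => //= v U' /andP[].
    case: X eX XV Xt => [|v X] /= eX XV Xt.
      by exists [::], j.+1; rewrite eX /= -addn1 addnC -drop_drop drop1.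
    by case/andP: XV => _ XV; exists X, j; rewrite eX; split => // l lX; apply: Xt; rewrite inE lX orbT.
  move=> v u c vtl vU uV utl ec.
  case: U iU qN idone eX vU {qst} => [|v' U] iU qN idone eX /= vU; first by apply: idone ec.
  have [e|ne] := eqVneq v v'.
    by apply: (qN _ _ _ _ erefl uV utl); rewrite -e.
  by apply: (idone v u) => //; rewrite inE negb_or ne.
have [v [U [eU uV utl cQ ec]]] := queryP qst.
have vtl : v \in st.1.1 by apply: (inv_sub ist); rewrite eU mem_head.
have Usub := inv_sub ist.
case: (ist) => iu iU [s es sV] [X [j [eX XV Xt]]] iq idone.
case: st {ist qst} iu iU es eX Xt iq idone eU utl cQ vtl Usub => [[tl U'] Q] /= iu iU es eX Xt iq idone eU utl cQ vtl Usub.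
case: b; split => //=.
- by rewrite utl.
- by rewrite iU andbT; apply: contra utl => /Usub; exact: map_f.
- by exists (u :: s); rewrite /= ?es ?uV.
- exists (u :: X), j; rewrite /= eX uV XV; split => // l; rewrite !inE => /orP[->//|/Xt->].
  by rewrite orbT.
- move=> c'; rewrite inE => /orP[/set1P->|/iq[v' v'tl nv']].
    by exists v; rewrite ?inE ?vtl ?orbT // ec set21.
  by exists v'; rewrite ?inE ?v'tl ?orbT.
- move=> v' u' c'; rewrite !inE => /orP[/eqP->|v'tl]; first by rewrite eqxx.
  rewrite !negb_or => /andP[_ v'U] u'V /andP[_ u'tl] ec'; apply/orP; right.
  exact: (idone v' u').
- by exists s.
- by exists X, j.
- move=> c'; rewrite inE => /orP[/set1P->|/iq//].
  by exists v; rewrite // ec set21.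
- move=> v' u' c' v'tl v'U u'V u'tl ec'; rewrite inE; apply/orP; right.
  exact: (idone v' u').
Qed.

Lemma dfs_inv_run k st F : dfs_inv st -> dfs_inv (dfs k st F).
Proof. by elim: k st => //= k IH st ist; apply: IH; exact: dfs_inv_next. Qed.

Lemma stack_uniq st : dfs_inv st -> uniq st.1.1.
Proof. by case=> iu _ _ _ _ _; exact: map_uniq iu. Qed.


(* Each literal that left the stack has been queried against every literal over
   an untouched variable. *)
Lemma done_count st : dfs_inv st ->
  ((size st.1.1 - size st.1.2) * (2 * (#|V| - size st.1.1)) <= #|st.2|)%N.
Proof.
move=> ist; have iu := inv_uniq ist; have ut := stack_uniq ist.
case: st ist iu ut => [[tl U] Q] /= ist iu ut.
pose D := [set v in tl | v \notin U].
pose W := [set i in V | i \notin map fst tl].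
pose A := finset.setX D (finset.setX W [set: bool]).
have cD : (size tl - size U <= #|D|)%N.
  rewrite leq_subLR; have <- : #|[set v in tl]| = size tl.
    by rewrite cardsE; apply/card_uniqP.
  have -> : [set v in tl] = ([set v in tl] :&: [set v in U]) :|: D.
    by apply/setP => v; rewrite !inE; case: (v \in tl); case: (v \in U).
  rewrite (leq_trans (leq_card_setU _ _)) // leq_add2r.
  apply: leq_trans (subset_leq_card (subsetIr _ _)) _.
  by rewrite cardsE; exact: card_size.
have cW : (#|V| - size tl <= #|W|)%N.
  rewrite leq_subLR; have <- : #|[set i in map fst tl]| = size tl.
    by rewrite cardsE -(size_map fst tl); apply/card_uniqP.
  apply: leq_trans (leq_card_setU _ _); apply: subset_leq_card.
  by apply/subsetP => i iV; rewrite !inE iV /=; case: (i \in _).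
have cA : #|A| = (#|D| * (2 * #|W|))%N.
  by rewrite !cardsX cardsT card_bool [(#|W| * 2)%N]mulnC.
apply: leq_trans (_ : #|A| <= _)%N; first by rewrite cA leq_mul // leq_mul2l cW orbT.
pose f (vu : literal n * literal n) := [pick c : clause n | val c == [set neg vu.1; vu.2]].
have fA vu : vu \in A -> exists2 c, f vu = Some c & (c \in Q) && (val c == [set neg vu.1; vu.2]).
  case: vu => v [i b]; rewrite !inE /= => /andP[/andP[vtl vU] /andP[/andP[iV itl] _]].
  have vi : v.1 != i by apply: contraNneq itl => <-; exact: map_f.
  have [c0 ec0 _] := imp_clause (vi : v.1 != (i, b).1).
  rewrite /f /=; case: pickP => [c ec|/(_ c0)]; last by rewrite ec0 eqxx.
  exists c => //; rewrite ec andbT.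
  by apply: (inv_done ist vtl vU _ _ (eqP ec)).
have finj : {in A &, injective f}.
  move=> [v u] [v' u'] vA vA'; have [c -> /andP[_ /eqP ec]] := fA _ vA.
  have [c' -> /andP[_ /eqP ec']] := fA _ vA' => -[cc]; move: ec; rewrite cc ec' /= => e.
  move: vA vA'; rewrite !inE => /andP[/andP[vtl _] /andP[/andP[_ utl] _]].
  case/andP=> /andP[v'tl _] /andP[/andP[_ u'tl] _].
  have h1 : neg v' \in [set neg v; u] by rewrite -e set21.
  have h2 : u' \in [set neg v; u] by rewrite -e set22.
  case/set2P: h1 => [/neg_inj ->|h1]; last first.
    by case/negP: utl; rewrite -h1 /=; exact: map_f.
  case/set2P: h2 => [h2|-> //].
  by case/negP: u'tl; rewrite h2 /=; exact: map_f.
have sinj : injective (@Some (clause n)) by move=> c c' [].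
rewrite -(card_in_imset finj) -(card_imset _ sinj).
apply: subset_leq_card; apply/subsetP => _ /imsetP[vu vuA ->].
by have [c -> /andP[cQ _]] := fA _ vuA; apply: imset_f.
Qed.

Variables (theta p gam : R) (tau : nat).
Hypotheses (p01 : 0 <= p <= 1) (theta01 : 0 <= theta <= 1) (gam0 : 0 <= gam).

(* A supermartingale: a query succeeds with probability p and then multiplies
   the first factor by 1 - theta. *)
Definition potential st : R :=
  gam * (1 - theta) ^+ (size st.1.1 - size U0) * (1 + theta * p) ^+ #|st.2|.

Definition bad st : bool := 1 <= potential st.

Hypothesis stopE : forall st, stop st = bad st || (tau <= size st.1.1)%N.

Definition fresh st (w : clause n -> R) := forall c v u, c \notin st.2 ->
  (v \in U0) || (v.1 \in V) -> u.1 \in V -> val c = [set neg v; u] -> w c = p.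

Lemma potential_ge0 st : 0 <= potential st.
Proof.
have [p0 p1] := andP p01; have [t0 t1] := andP theta01.
by rewrite /potential !mulr_ge0 // exprn_ge0 ?subr_ge0 // addr_ge0 // mulr_ge0.
Qed.

Lemma Ex_dfs (eps : R) (g : dfs_state -> formula n -> R) :
  (forall st w, is_prob w -> dfs_inv st -> fresh st w -> Ex w (g st) <= potential st + eps) ->
  forall k w, is_prob w -> fresh (U0, U0, set0) w ->
    Ex w (fun F => g (dfs k (U0, U0, set0) F) F) <= gam + eps.
Proof.
move=> hg k w pw fw; have := dfs_inv_init; move: fw => fw iw.
have -> : gam + eps = potential (U0, U0, set0) + eps.
  by rewrite /potential /= subnn expr0 cards0 expr0 !mulr1.
apply: (Ex_adaptive (Inv := fun st w => dfs_inv st /\ fresh st w)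
  (Psi := fun st => potential st + eps) (g := g)) => //.
- by move=> st w' pw' [i f]; exact: hg.
- move=> st w' pw' [i f] qN; split; first split.
  + exact: dfs_inv_next.
  + move: qN; rewrite /dfs_q /dfs_next; case: ifP => // _.
    by case: (query st).
  + move: qN; rewrite /dfs_q /dfs_next; case: ifP => // _.
    by case: (query st).
- move=> st w' c pw' [i f] qS; move: qS; rewrite /dfs_q; case: ifP => // sst.
  case qst : (query st) => [[u c']|] //= [ecc]; subst c'.
  have [v [U [eU uV utl cQ ec]]] := queryP qst.
  have fr b e : fresh (dfs_next st b) (upd w' c e).
    rewrite /dfs_next sst qst /= => c' v' u'; rewrite /= inE => /norP[cc' c'Q].
    rewrite /upd; move: cc'; rewrite inE => /negbTE ->; exact: f c'Q.
  have wc : w' c = p.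
    apply: (f c v u) => //.
    have : v \in st.1.1 by apply: (inv_sub i); rewrite eU mem_head.
    have [s -> /allP sV] := inv_tl i; rewrite mem_cat => /orP[/sV->|->//].
    by rewrite orbT.
  split; [by split; [exact: dfs_inv_next|exact: fr] | by split; [exact: dfs_inv_next|exact: fr] |].
  rewrite wc /dfs_next sst qst /potential /=.
  have sz : (size U0 <= size st.1.1)%N.
    by have [s -> _] := inv_tl i; rewrite size_cat leq_addl.
  rewrite cardsU1 cQ add1n subSn // !exprS.
  set a := _ ^+ _; set b := _ ^+ _.
  have [p0 p1] := andP p01; have [t0 t1] := andP theta01.
  have a0 : 0 <= a by rewrite exprn_ge0 // subr_ge0.
  have b0 : 0 <= b by rewrite exprn_ge0 // addr_ge0 // mulr_ge0.
  have G0 : 0 <= gam * a * b by rewrite !mulr_ge0.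
  (* The expected multiplier of one query is (1 + theta p) (1 - theta p) = 1 - (theta p)^2; this
     term is the defect. *)
  have G1 : 0 <= gam * a * b * (theta * p) ^+ 2 by rewrite mulr_ge0 // sqr_ge0.
  nra.
Qed.

(** Markov's inequality for the potential. As the search freezes once it is bad, being bad at the
    end covers being bad at any time. *)
Lemma Pr_bad k w : is_prob w -> fresh (U0, U0, set0) w ->
  Pr w (fun F => bad (dfs k (U0, U0, set0) F)) <= gam.
Proof.
move=> pw fw; rewrite -[gam]addr0.
apply: (@Ex_dfs 0 (fun st F => (bad st)%:R)) => // st w' pw' _ _.
by rewrite Ex_cst addr0; case hb : (bad st); [exact: hb|exact: potential_ge0].
Qed.

Variables (eta x : R).
Hypothesis eta0 : 0 < eta.
(** What the potential staying below 1 has to give: t queries produce almost p t successes s, and d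
    finished literals account for d * 2 (|V| - tau) queries, so a supercritical search finds more
    literals than it finishes, up to the deficit x. *)
Hypothesis good_search : forall s t d : nat,
  gam * (1 - theta) ^+ s * (1 + theta * p) ^+ t < 1 ->
  (d * (2 * (#|V| - tau)) <= t)%N -> (1 + eta) * d%:R <= s%:R + x.
Hypothesis x_lt : x < (size U0)%:R.
Hypothesis U0_tau : (size U0 <= tau)%N.

(** k is the height of the stack and m the number of literals found: the m - k finished ones are
    paid for by the growth of the stack. In particular the stack cannot be empty when x is below the
    number of roots. *)
Definition balanced (k m : nat) : Prop :=
  eta * (m%:R - k%:R) <= k%:R - (size U0)%:R + x.

Lemma good_balanced st : dfs_inv st -> (size st.1.2 <= size st.1.1 <= tau)%N -> ~~ bad st ->
  balanced (size st.1.2) (size st.1.1).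
Proof.
move=> ist /andP[Utl tlt]; rewrite /bad -ltNge => nb.
have sz : (size U0 <= size st.1.1)%N.
  by have [s -> _] := inv_tl ist; rewrite size_cat leq_addl.
have := good_search nb (leq_trans _ (done_count ist)).
move/(_ (size st.1.1 - size st.1.2)%N).
rewrite leq_mul // ?leq_mul2l ?leq_sub2l ?orbT // => /(_ isT).
rewrite natrB // [in X in _ <= X -> _]natrB // /balanced.
move: (size _)%:R (size _)%:R (size _)%:R => A B C; lra.
Qed.

Variable F : formula n.

(** As long as r is on the stack, everything found after r descends from r. Both lists have the
    latest entry first, so [size - index] recovers the stack height and the number of found literals
    at the moment r was pushed. Roots are exempt because they need not imply one another. *)
Record dfs_good st : Prop := DfsGood {
  good_stack : uniq st.1.2;
  good_reach : forall a, a \in st.1.1 -> exists2 b, b \in U0 & connect (imp F) b a;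
  good_chain : pairwise (fun v r => (r \in U0) || connect (imp F) r v) st.1.2;
  good_desc : forall r a, r \in st.1.2 -> r \notin U0 ->
    a \in take (index r st.1.1) st.1.1 -> connect (imp F) r a;
  good_push : forall r, r \in st.1.2 -> r \notin U0 ->
    balanced (size st.1.2 - index r st.1.2) (size st.1.1 - index r st.1.1);
  good_size : (size st.1.1 <= tau)%N }.

Definition dfs_step st := dfs_next st (if dfs_q st is Some c then c \in F else false).

Lemma dfs_good_init : dfs_good (U0, U0, set0).
Proof.
split => //=.
- exact: map_uniq U0_uniq.
- by move=> a aU; exists a => //; exact: connect0.
- have: {subset U0 <= U0} by [].
  elim: {1 4}U0 => //= v s IH sU; rewrite IH ?andbT => [|l ls]; last first.
    by apply: sU; rewrite inE ls orbT.
  by apply/allP => r rs; rewrite sU // inE rs orbT.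
- by move=> r a ->.
- by move=> r ->.
Qed.

Lemma dfs_good_step st : dfs_inv st -> dfs_good st -> ~~ bad (dfs_step st) ->
  dfs_good (dfs_step st).
Proof.
move=> ist gst; rewrite /dfs_step /dfs_q; case sst : (stop st).
  by rewrite /dfs_next sst.
case qst : (query st) => [[u c]|] /=; last first.
  move=> _; rewrite /dfs_next sst qst; case: gst.
  case: st {ist sst qst} => [[tl [|v U]] Q] //= uU gr gc gd gp gs.
  case/andP: uU => vU uU; split => //=.
  - by case/andP: gc.
  - by move=> r a rU; apply: gd; rewrite inE rU orbT.
  - move=> r rU rU0; have := gp r; rewrite inE rU orbT => /(_ isT rU0).
    have vr : (v == r) = false by apply/negbTE; apply: contraNneq vU => ->.
    by rewrite vr subSS.
have [v [U [eU uV utl cQ ec]]] := queryP qst.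
have [cF|cF] := boolP (c \in F); last first.
  by move=> _; rewrite /dfs_next sst qst; case: gst.
move=> nb; have iN := dfs_inv_next true ist; move: nb iN.
have [uU gr gc gd gp gs] := gst.
have vtl : v \in st.1.1 by apply: (inv_sub ist); rewrite eU mem_head.
have Usub := inv_sub ist.
have szU : (size st.1.2 <= size st.1.1)%N by exact: uniq_leq_size.
have tt : (size st.1.1 < tau)%N.
  by move: sst; rewrite stopE => /negbT; rewrite negb_or => /andP[_]; rewrite -ltnNge.
rewrite /dfs_next sst qst /=.
have vu : imp F v u by apply/existsP; exists c; rewrite cF ec /=.
case: st {ist sst qst gst} eU utl cQ vtl Usub szU tt uU gr gc gd gp gs
  => [[tl U'] Q] /= eU; rewrite {U'}eU => utl cQ vtl Usub szU tt uU gr gc gd gp gs nb iN.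
have utl' : u \notin tl by apply: contra utl; exact: map_f.
have uvU : u \notin v :: U by apply: contra utl'; exact: Usub.
have ru r : r \in v :: U -> r \notin U0 -> connect (imp F) r u.
  move=> rU rU0; apply: connect_trans (connect1 vu).
  move: rU; rewrite inE => /predU1P[->|rU]; first exact: connect0.
  by case/andP: gc => /allP/(_ _ rU); rewrite (negbTE rU0).
have nru r : r \in v :: U -> r != u by move=> rU; apply: contraNneq uvU => <-.
split.
- by rewrite /= uvU.
- move=> a; rewrite /= inE => /predU1P[->|/gr//].
  have [b bU0 bv] := gr _ vtl; exists b => //; exact: connect_trans bv (connect1 vu).
- apply/andP; split => //; apply/allP => r rU; case rU0 : (r \in U0) => //=.
  by apply: ru; rewrite ?rU0.
- move=> r a; rewrite /= inE => /predU1P[->|rU] rU0; first by rewrite eqxx.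
  rewrite eq_sym (negbTE (nru _ rU)) /= inE => /predU1P[->|]; first exact: ru.
  exact: gd.
- move=> r; rewrite [r \in _]inE => /predU1P[->|rU] rU0 /=.
    rewrite eqxx !subn0; apply: (good_balanced iN) nb => /=.
    by rewrite !ltnS szU.
  rewrite eq_sym (negbTE (nru _ rU)) !subSS; exact: gp.
- by [].
Qed.

Lemma dfsS k st : dfs k.+1 st F = dfs k (dfs_step st) F. Proof. by []. Qed.

Lemma dfs_stopped k st : stop st -> dfs k st F = st.
Proof. by move=> s; elim: k => // k IH; rewrite dfsS /dfs_step /dfs_next s. Qed.

Lemma dfs_bad k st : bad st -> dfs k st F = st.
Proof. by move=> b; apply: dfs_stopped; rewrite stopE b. Qed.

Lemma dfs_good_run k st : dfs_inv st -> dfs_good st -> ~~ bad (dfs k st F) ->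
  dfs_good (dfs k st F).
Proof.
elim: k st => // k IH st ist gst nb.
have nb1 : ~~ bad (dfs_step st).
  by apply: contra nb => b1; rewrite dfsS dfs_bad.
by apply: IH => //; [exact: dfs_inv_next|exact: dfs_good_step].
Qed.

(** Each step before stopping increases queries plus finished literals by one: it either queries a
    clause or pops. An empty stack is ruled out by [balanced]. *)
Lemma dfs_stops k st : dfs_inv st -> dfs_good st -> ~~ bad (dfs k st F) ->
  stop (dfs k st F) \/
  (#|st.2| + (size st.1.1 - size st.1.2) + k <=
   #|(dfs k st F).2| + (size (dfs k st F).1.1 - size (dfs k st F).1.2))%N.
Proof.
elim: k st => [|k IH] st ist gst nb; first by right; rewrite addn0.
have nb1 : ~~ bad (dfs_step st).
  by apply: contra nb => b1; rewrite dfsS dfs_bad.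
have i1 : dfs_inv (dfs_step st) by exact: dfs_inv_next.
have g1 := dfs_good_step ist gst nb1.
have := IH _ i1 g1 nb; rewrite -dfsS.
move=> [->|h]; [by left|].
case sst : (stop st).
  by left; rewrite dfs_stopped.
right; apply: leq_trans h; rewrite addnS -addSn leq_add2r.
have szU : (size st.1.2 <= size st.1.1)%N.
  by apply: uniq_leq_size; [exact: good_stack gst|exact: inv_sub ist].
rewrite /dfs_step /dfs_q sst; case qst : (query st) => [[u c]|] /=.
  have [v [U [eU uV utl cQ ec]]] := queryP qst.
  rewrite /dfs_next sst qst /= cardsU1 cQ add1n addSn ltnS.
  by case: (c \in F); rewrite /= ?subSS.
rewrite /dfs_next sst qst /=; case eU : st.1.2 szU => [|v U] /= szU.
  have nb0 : ~~ bad st by move: sst; rewrite stopE => /negbT; rewrite negb_or => /andP[].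
  have := good_balanced ist _ nb0; rewrite eU /= (good_size gst) => /(_ isT).
  rewrite /balanced subr0 sub0r => h.
  have : 0 <= eta * (size st.1.1)%:R by rewrite mulr_ge0 // ltW.
  by move: x_lt h; lra.
by rewrite -addnS leq_add2l -subSn // subSS.
Qed.

Definition dfs_fuel := (#|{: clause n}| + n).+1.
Definition dfs_end := dfs dfs_fuel (U0, U0, set0) F.

Lemma dfs_end_inv : dfs_inv dfs_end.
Proof. by apply: dfs_inv_run; exact: dfs_inv_init. Qed.

Lemma dfs_end_good : ~~ bad dfs_end -> dfs_good dfs_end /\ (size dfs_end.1.1 = tau).
Proof.
move=> nb; have g : dfs_good dfs_end.
  by apply: dfs_good_run nb; [exact: dfs_inv_init|exact: dfs_good_init].
split => //; apply/eqP; rewrite eqn_leq (good_size g) /=.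
have [] := dfs_stops dfs_inv_init dfs_good_init nb.
  by rewrite stopE -/dfs_end (negbTE nb).
rewrite -/dfs_end cards0 subnn addn0 add0n => h; exfalso.
have h1 : (#|dfs_end.2| <= #|{: clause n}|)%N by exact: max_card.
have h2 : (size dfs_end.1.1 <= n)%N.
  rewrite -(size_map fst) -[X in (_ <= X)%N]card_ord.
  apply: leq_trans (max_card [in map fst dfs_end.1.1]).
  by rewrite (card_uniqP (inv_uniq dfs_end_inv)).
have : (dfs_fuel <= #|{: clause n}| + n)%N.
  by apply: leq_trans h _; apply: leq_add => //; apply: leq_trans h2; exact: leq_subr.
by rewrite /dfs_fuel ltnn.
Qed.

End Search.

Lemma uniq_map_in (A B : eqType) (f : A -> B) (s : seq A) :
  uniq (map f s) -> {in s &, injective f}.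
Proof.
move=> us v v' /(nthP v)[i si <-] /(nthP v)[j sj <-].
rewrite -!(nth_map v (f v)) // => /eqP; rewrite nth_uniq ?size_map //.
by move/eqP->.
Qed.

(** * Two successive searches, the second from negated ancestors *)

Section TwoSearches.
Context {R : realFieldType} {n : nat}.
Implicit Types (x y z u v r a : literal n) (F : formula n) (tl U : seq (literal n)).
Implicit Types (c : clause n) (Q : {set clause n}) (st : @dfs_state n).

Variables (theta p gam eta xs : R) (tau kap : nat).
Hypotheses (p01 : 0 <= p <= 1) (theta01 : 0 <= theta <= 1) (gam0 : 0 <= gam).
Hypothesis eta0 : 0 < eta.
(** n - 3 tau serves both searches: the reserved roots remove kap <= tau variables, the first search
    touches at most tau, and the running search itself at most tau. *)
Hypothesis search : forall s t d : nat,
  gam * (1 - theta) ^+ s * (1 + theta * p) ^+ t < 1 ->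
  (d * (2 * (n - 3 * tau)) <= t)%N -> (1 + eta) * d%:R <= s%:R + xs.
Hypothesis xs_lt : xs < kap%:R.
Hypothesis kap_gt0 : (0 < kap)%N.
Hypothesis kap_tau : (kap <= tau)%N.
Hypothesis tau_n : (tau <= n)%N.
(** To be read with [balanced]: once tau literals are found the stack has height at least 2 kap,
    and, by the next hypothesis, at most half of the tau literals had been found when the element at
    height 2 kap was pushed. *)
Hypothesis long_stack : forall u : nat, (u <= tau)%N ->
  eta * (tau%:R - u%:R) <= u%:R - kap%:R + xs -> (2 * kap <= u)%N.
Hypothesis early_push : forall m : nat,
  eta * (m%:R - (2 * kap)%:R) <= (2 * kap)%:R - kap%:R + xs -> (2 * m <= tau)%N.

Definition halt (U0 : seq (literal n)) : pred dfs_state :=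
  fun st => bad U0 theta p gam st || (tau <= size st.1.1)%N.

Lemma haltE U0 st : halt U0 st = bad U0 theta p gam st || (tau <= size st.1.1)%N.
Proof. by []. Qed.

Definition V1 : {set 'I_n} := [set i : 'I_n | (kap <= i)%N].
(** A reserve of kap starting literals over variables withheld from the search: it absorbs the
    deficit xs, so the stack never runs empty. *)
Definition roots1 : seq (literal n) := [seq (i, true) | i <- enum (~: V1)].
Definition end1 F := dfs_end V1 (halt roots1) roots1 F.

Definition V2 st : {set 'I_n} := V1 :\: [set i in map fst st.1.1].

(* The kap literals of the tree path of the first search below the stack
   position 2 kap, negated, are the roots of the second search. *)
Definition pivots st : seq (literal n) :=
  take kap (drop (size st.1.2 - 2 * kap) [seq v <- st.1.2 | v.1 \in V1]).
Definition roots2 st := map neg (pivots st).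
Definition end2 st F := dfs_end (V2 st) (halt (roots2 st)) (roots2 st) F.

Lemma roots1_uniq : uniq (map fst roots1).
Proof. by rewrite -map_comp map_id_in ?enum_uniq // => i _. Qed.

Lemma roots1_V : all (fun l => l.1 \notin V1) roots1.
Proof. by apply/allP => l /mapP[i]; rewrite mem_enum inE => iV ->. Qed.

Lemma size_roots1 : size roots1 = kap.
Proof.
rewrite size_map -cardE -sum1_card (eq_bigl (fun i : 'I_n => (i < kap)%N)); last first.
  by move=> i; rewrite !inE ltnNge.
rewrite -(big_ord_widen n (fun=> 1%N)) ?sum1_card ?card_ord //.
exact: leq_trans kap_tau tau_n.
Qed.

Lemma card_V1 : #|V1| = (n - kap)%N.
Proof.
by rewrite cardsCs card_ord -[in RHS]size_roots1 size_map -cardE.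
Qed.

Lemma pivots_sub st : {subset pivots st <= [seq v <- st.1.2 | v.1 \in V1]}.
Proof. by move=> v /mem_take/mem_drop. Qed.

Lemma roots2_uniq st : dfs_inv V1 roots1 st -> uniq (map fst (roots2 st)).
Proof.
move=> ist; rewrite -map_comp map_inj_in_uniq.
  by rewrite take_uniq // drop_uniq // filter_uniq // (inv_U ist).
have sub v : v \in pivots st -> v \in st.1.1.
  by move/pivots_sub; rewrite mem_filter => /andP[_ /(inv_sub ist)].
by move=> v v' /sub vt /sub v't /=; exact: (uniq_map_in (inv_uniq ist)).
Qed.

Lemma roots2_touched st v : dfs_inv V1 roots1 st -> v \in roots2 st ->
  (neg v \in st.1.1) && (v.1 \in V1).
Proof.
move=> ist /mapP[r /pivots_sub]; rewrite mem_filter => /andP[rV /(inv_sub ist) rt] ->.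
by rewrite negK rt.
Qed.

(** A clause revealed by the first search contains the negation of a found literal. A root of the
    second search is itself the negation of a found literal, so it was not found, and all other
    literals in play are untouched; hence the second search only meets unrevealed clauses. *)
Lemma fresh2 st w : dfs_inv V1 roots1 st -> fresh V1 roots1 p st w ->
  fresh (V2 st) (roots2 st) p (roots2 st, roots2 st, set0) w.
Proof.
move=> ist fst1 c v u _ hv uV2 ec.
have [ut uV1] : u.1 \notin map fst st.1.1 /\ u.1 \in V1.
  by move: uV2; rewrite !inE => /andP[].
have vV1 : v.1 \in V1.
  case/orP: hv => [/(roots2_touched ist)/andP[]//|]; by rewrite !inE => /andP[].
apply: (fst1 c v u) => //; last by rewrite vV1 orbT.
apply/negP => /(inv_queried ist)[v' v't]; rewrite ec => /set2P[/neg_inj e|e]; last first.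
  by case/negP: ut; rewrite -e; exact: (map_f fst v't).
case/orP: hv => [/(roots2_touched ist)/andP[nvt _]|]; last first.
  by rewrite !inE -e (map_f fst v't).
rewrite e in v't; have := neg_neq v.
by rewrite (uniq_map_in (inv_uniq ist) nvt v't) ?eqxx.
Qed.

Lemma Pr_two_searches w : is_prob w -> (forall c, w c = p) ->
  Pr w (fun F => bad roots1 theta p gam (end1 F) ||
                 bad (roots2 (end1 F)) theta p gam (end2 (end1 F) F)) <= gam + gam.
Proof.
move=> pw wp.
pose g st F : R := (bad roots1 theta p gam st ||
  bad (roots2 st) theta p gam (end2 st F))%:R.
have fw : fresh V1 roots1 p (roots1, roots1, set0) w by move=> c v u _ _ _ _; exact: wp.
suff hg st w' : is_prob w' -> dfs_inv V1 roots1 st -> fresh V1 roots1 p st w' ->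
    Ex w' (g st) <= potential roots1 theta p gam st + gam.
  exact: (Ex_dfs (halt roots1) roots1_uniq p01 theta01 gam0 hg (@dfs_fuel n) pw fw).
move=> pw' ist fst1; rewrite /g -/(Pr _ _).
apply: le_trans (Pr_or _ _ pw') _; apply: lerD.
  rewrite [Pr _ _]Ex_cst; case b : (bad _ _ _ _ st); first exact: b.
  exact: potential_ge0.
have u2 := roots2_uniq ist; have f2 := fresh2 ist fst1.
exact: (Pr_bad (halt (roots2 st)) u2 p01 theta01 gam0 (@dfs_fuel n) pw' f2).
Qed.

Definition vreach F r : {set 'I_n} := [set i | [exists b, connect (imp F) r (i, b)]].

(* Let r be the stack element at height 2 kap at the end of the first search.
   It was pushed early, so most touched literals are its descendants; the pivots
   are its ancestors, so [neg r] leads to every root of the second search. *)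
Lemma two_searches F :
  ~~ (bad roots1 theta p gam (end1 F) ||
      bad (roots2 (end1 F)) theta p gam (end2 (end1 F) F)) ->
  exists r, (tau <= 2 * #|vreach F r|)%N && (tau <= 2 * #|vreach F (neg r)|)%N.
Proof.
rewrite negb_or; set st := end1 F => /andP[nb1 nb2].
have cV1 := card_V1; have sr1 := size_roots1.
have search1 : forall s t d : nat,
  gam * (1 - theta) ^+ s * (1 + theta * p) ^+ t < 1 ->
  (d * (2 * (#|V1| - tau)) <= t)%N -> (1 + eta) * d%:R <= s%:R + xs.
  move=> s t d h1 h2; apply: search h1 _; apply: leq_trans h2.
  by rewrite cV1 !leq_mul2l; move: kap_tau; clear => ?; apply/orP; right; lia.
have xs1 : xs < (size roots1)%:R by rewrite sr1.
have kt1 : (size roots1 <= tau)%N by rewrite sr1.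
have ist : dfs_inv V1 roots1 st := @dfs_end_inv _ _ _ _ roots1_uniq F.
have [gst tst] : dfs_good roots1 tau eta xs F st /\ size st.1.1 = tau :=
  dfs_end_good (V := V1) (stop := halt roots1) roots1_uniq (haltE roots1) eta0 search1 xs1 kt1 nb1.
clearbody st; have Usub := inv_sub ist.
have iU := inv_U ist; have itl := inv_uniq ist.
have Ut : (size st.1.2 <= tau)%N by rewrite -tst; exact: uniq_leq_size iU Usub.
have Ubig : (2 * kap <= size st.1.2)%N.
  apply: long_stack => //; have := good_balanced search1 ist _ nb1.
  by rewrite /balanced tst sr1 Ut leqnn => /(_ isT).
have [X [j [eU XV _]]] := inv_stack ist.
have eX : [seq v <- st.1.2 | v.1 \in V1] = X.
  rewrite eU filter_cat (all_filterP XV) (@eq_in_filter _ _ pred0) ?filter_pred0 ?cats0 //.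
  by move=> v /mem_drop vr; apply/negbTE; exact: (allP roots1_V).
set idx := (size st.1.2 - 2 * kap)%N.
have Xsz : (size st.1.2 <= size X + kap)%N.
  by rewrite eU size_cat leq_add2l size_drop sr1 leq_subr.
have idxX : (idx + kap <= size X)%N by rewrite /idx; move: (size X) (size st.1.2) Xsz Ubig => a b; clear; lia.
case eD : (drop idx X) => [|r D].
  move: (congr1 size eD) idxX kap_gt0; rewrite size_drop /=.
  by move: (size X) (idx) => a b; clear; lia.
have dU : drop idx st.1.2 = r :: D ++ drop j roots1.
  rewrite eU drop_cat; case: ltnP => h; first by rewrite eD.
  by move: (size X) (idx) idxX h kap_gt0 => a b; clear; lia.
have rX : r \in X by apply: (@mem_drop idx); rewrite eD mem_head.
have rU : r \in st.1.2 by rewrite eU mem_cat rX.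
have nroot v : v \in X -> v \notin roots1.
  by move=> vX; apply: contraL (allP XV _ vX) => /(allP roots1_V).
have ir : index r st.1.2 = idx.
  rewrite -(cat_take_drop idx st.1.2) dU index_cat /= eqxx addn0.
  move: iU; rewrite -{1}(cat_take_drop idx st.1.2) dU cat_uniq /= => /and3P[_ /norP[/negbTE -> _] _].
  rewrite size_take; case: ltnP => //; rewrite /idx.
  by move: (size st.1.2) kap_gt0 Ubig => a; clear; lia.
have pr := good_push gst rU (nroot _ rX).
have early : (2 * (tau - index r st.1.1) <= tau)%N.
  apply: early_push; move: pr; rewrite /balanced ir tst sr1.
  by rewrite (_ : (size st.1.2 - idx)%N = (2 * kap)%N) // /idx subKn.
have vreach_ge (s : seq (literal n)) q : uniq (map fst s) ->
    (forall a, a \in s -> connect (imp F) q a) -> (size s <= #|vreach F q|)%N.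
  move=> us hs; rewrite -(size_map fst) -(card_uniqP us); apply: subset_leq_card.
  apply/subsetP => i /mapP[[i' b] /hs h ->]; rewrite inE.
  by apply/existsP; exists b.
exists r; apply/andP; split.
  apply: leq_trans (_ : 2 * size (take (index r st.1.1) st.1.1) <= _)%N.
    rewrite size_take tst; move: (index r st.1.1) early => a; clear.
    by case: ltnP; lia.
  rewrite leq_mul2l; apply: vreach_ge; last by move=> a; exact: (good_desc gst rU (nroot _ rX)).
  by rewrite map_take take_uniq.
have s2 : size (roots2 st) = kap.
  rewrite size_map /pivots eX -/idx size_takel // size_drop.
  by move: (size X) (idx) idxX => a b; clear; lia.
have inv2 := roots2_uniq ist.
have search2 : forall s t d : nat,
  gam * (1 - theta) ^+ s * (1 + theta * p) ^+ t < 1 ->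
  (d * (2 * (#|V2 st| - tau)) <= t)%N -> (1 + eta) * d%:R <= s%:R + xs.
  move=> s t d h1 h2; apply: search h1 _; apply: leq_trans h2.
  have : (#|V1| <= #|V2 st| + tau)%N.
    rewrite -tst -(size_map fst) -(card_uniqP itl).
    rewrite -(cardsID [set i in map fst st.1.1] V1) addnC leq_add2l.
    apply: subset_leq_card; apply/subsetP => i; by rewrite !inE => /andP[].
  rewrite cV1 !leq_mul2l; move: kap_tau; move: #|V2 st| => a; clear => h1 h2.
  by apply/orP; right; apply/orP; right; lia.
have xs2 : xs < (size (roots2 st))%:R by rewrite s2.
have kt2 : (size (roots2 st) <= tau)%N by rewrite s2.
have [gst2 tst2] : dfs_good (roots2 st) tau eta xs F (end2 st F) /\ size (end2 st F).1.1 = tau :=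
  dfs_end_good (V := V2 st) (stop := halt (roots2 st)) inv2 (haltE (roots2 st)) eta0 search2 xs2 kt2 nb2.
have ist2 := @dfs_end_inv _ (V2 st) (halt (roots2 st)) _ inv2 F.
apply: leq_trans (_ : 2 * size (end2 st F).1.1 <= _)%N.
  by rewrite tst2; apply: leq_pmull.
rewrite leq_mul2l; apply: vreach_ge; first exact: inv_uniq ist2.
move=> a /(good_reach gst2)[b /mapP[v vp ->]]; apply: connect_trans.
rewrite connect_neg.
have : v \in r :: D.
  by move: vp; rewrite /pivots eX -/idx eD => /mem_take.
rewrite inE => /predU1P[->|vD]; first exact: connect0.
have := good_chain gst; rewrite -(cat_take_drop idx st.1.2) dU pairwise_cat.
case/and3P=> _ _ /= /andP[/allP/(_ v)]; rewrite mem_cat vD => /(_ isT) h _.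
move: h; rewrite (negbTE (nroot v _)) //.
by apply: (@mem_drop idx); rewrite eD inE vD orbT.
Qed.

End TwoSearches.

(** * Upper bound on the probability of satisfiability *)

Section TwoRounds.
Context {R : realFieldType} {I : finType}.
Implicit Types (w : I -> R) (h : {set I} -> R) (F T : {set I}) (c : I).

Lemma Ex_force_setU w T h : Ex (force w T) h = Ex w (fun F => h (T :|: F)).
Proof.
move: h; have [m] := ubnP #|T|; elim: m T => // m IH T; rewrite ltnS => Tm h.
have [->|[c cT]] := set_0Vmem T.
  by apply: eq_Ex => [i|F]; rewrite ?set0U // /force inE.
have cT' : (#|T :\ c| < m)%N by rewrite (leq_trans _ Tm) // [X in (_ < X)%N](cardsD1 c) cT.
rewrite (@eq_Ex _ _ _ (upd (force w (T :\ c)) c 1) h h) // => [|i]; last first.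
  by rewrite /upd /force !inE; case: (eqVneq i c) => [->|]; rewrite ?cT.
rewrite Ex_upd1 (@Ex_upd_indep _ _ _ (fun F => h (c |: F))) => [|F]; last first.
  by rewrite setUA setUid.
by rewrite (IH _ cT'); apply: eq_Ex => // F; rewrite setUA setD1K.
Qed.

Lemma Ex_upd_linear w c b h :
  Ex (upd w c b) h = b * Ex (upd w c 1) h + (1 - b) * Ex (upd w c 0) h.
Proof.
have e a : Ex (upd (upd w c b) c a) h = Ex (upd w c a) h.
  by apply: eq_Ex => // i; rewrite /upd; case: eqP.
by rewrite (Ex_split (upd w c b) h c) !e [upd w c b c]/upd eqxx.
Qed.

Lemma Ex_two_rounds (w1 w2 : I -> R) h : is_prob w1 ->
  Ex (fun c => w1 c + w2 c - w1 c * w2 c) h =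
  Ex w1 (fun F1 => Ex w2 (fun F2 => h (F1 :|: F2))).
Proof.
move=> pw1; move: w1 pw1; apply: weight_ind => [w1 pw1 det|w1 c pw1 IH1 IH0].
  rewrite [RHS]Ex_det // -Ex_force_setU; apply: eq_Ex => // c.
  rewrite /force inE; have := det c; case: (eqVneq (w1 c) 1) => [->|_].
    by move=> _; ring.
  by rewrite orbF => /eqP->; ring.
set W := fun c => _.
have eW b : Ex (fun i => upd w1 c b i + w2 i - upd w1 c b i * w2 i) h =
    Ex (upd W c (b + w2 c - b * w2 c)) h.
  by apply: eq_Ex => // i; rewrite /upd /W; case: eqP => // ->.
rewrite [RHS](Ex_split _ _ c) -IH1 -IH0 !eW (Ex_split W _ c).
rewrite !(Ex_upd_linear W c (_ + _ - _)) /W; ring.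
Qed.

Lemma Pr_avoid w T : Pr w (fun F => [disjoint T & F]) = \prod_(i in T) (1 - w i).
Proof.
have [m] := ubnP #|T|; elim: m T w => // m IH T w; rewrite ltnS => Tm.
have [->|[c cT]] := set_0Vmem T.
  rewrite big_set0 (@eq_Pr _ _ _ _ predT) ?[Pr _ _]Ex_cst // => F.
  by rewrite disjoints_subset sub0set.
have cT' : (#|T :\ c| < m)%N by rewrite (leq_trans _ Tm) // [X in (_ < X)%N](cardsD1 c) cT.
have e F : [disjoint T & F] = (c \notin F) && [disjoint T :\ c & F].
  by rewrite -{1}(setD1K cT) !disjoints_subset subUset sub1set inE.
have A_c F : [disjoint T :\ c & c |: F] = [disjoint T :\ c & F].
  by rewrite !disjoints_subset setCU subsetI setDE subsetIr.
have := Pr_mem_indep w A_c; rewrite (big_setD1 c cT) /= (eq_Pr _ e) -IH //.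
rewrite mulrBl mul1r => <-; rewrite /Pr -ExB; apply: eq_Ex => // F.
by case: (c \in F) => /=; rewrite ?subrr ?subr0.
Qed.

End TwoRounds.

Section UpperBound.
Context {R : realFieldType} {n : nat}.
Implicit Types (x y z u v r a : literal n) (F : formula n) (c : clause n).

(* Adding one of these clauses makes r lead to its own negation. *)
Definition blockers F r : {set clause n} :=
  [set c : clause n | [exists a, exists b, [&& connect (imp F) r a, connect (imp F) r b &
     val c == [set neg a; neg b]]]].

(** Mapping a clause to its pair of variables reaches every pair inside [vreach F r], so reaching a
    variable with either sign is enough. *)
Lemma card_blockers F r : ('C(#|vreach F r|, 2) <= #|blockers F r|)%N.
Proof.
rewrite -cards_draws; pose f (c : clause n) := [set l.1 | l in val c].
apply: leq_trans (leq_imset_card f _); apply: subset_leq_card.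
apply/subsetP => S; rewrite inE => /andP[Sr /cards2P[i [j [ij eS]]]].
move: Sr; rewrite eS subUset !sub1set !inE.
case/andP=> /existsP[bi ri] /existsP[bj rj].
have [c ec _] := imp_clause (ij : (i, bi).1 != (neg (j, bj)).1).
apply/imsetP; exists c; last first.
  by apply/setP => k; rewrite /f ec imsetU !imset_set1 /= !inE.
rewrite inE; apply/existsP; exists (i, bi); apply/existsP; exists (j, bj).
by rewrite ri rj ec eqxx.
Qed.

Lemma sat_blockers F1 F2 r : satisfiable (F1 :|: F2) ->
  [disjoint blockers F1 r & F2] || [disjoint blockers F1 (neg r) & F2].
Proof.
move=> /existsP[al sat]; apply: contraT; rewrite negb_or => /andP[].
have no q : ~~ [disjoint blockers F1 q & F2] -> ~~ lit_true al q.
  case/pred0Pn=> c /andP[] /=; rewrite inE.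
  case/existsP=> a /existsP[b /and3P[qa qb /eqP ec]] cF; apply/negP => tq.
  have ext u v : connect (imp F1) u v -> connect (imp (F1 :|: F2)) u v.
    by apply: connect_imp_mono; exact: subsetUl.
  have ta := sat_connect sat (ext _ _ qa) tq.
  have tb := sat_connect sat (ext _ _ qb) tq.
  have ab : imp (F1 :|: F2) a (neg b).
    by apply/existsP; exists c; rewrite inE cF orbT ec eqxx.
  by have := sat_imp sat ab ta; rewrite lit_true_neg tb.
by move=> /no h1 /no; rewrite lit_true_neg h1.
Qed.

Variables (theta p p2 q gam eta xs : R) (tau kap : nat).
Hypotheses (p01 : 0 <= p <= 1) (theta01 : 0 <= theta <= 1) (gam0 : 0 <= gam).
Hypotheses (p201 : 0 <= p2 <= 1) (q01 : 0 <= q <= 1) (hpq : p + p2 <= q).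
Hypothesis eta0 : 0 < eta.
Hypothesis search : forall s t d : nat,
  gam * (1 - theta) ^+ s * (1 + theta * p) ^+ t < 1 ->
  (d * (2 * (n - 3 * tau)) <= t)%N -> (1 + eta) * d%:R <= s%:R + xs.
Hypothesis xs_lt : xs < kap%:R.
Hypothesis kap_gt0 : (0 < kap)%N.
Hypothesis kap_tau : (kap <= tau)%N.
Hypothesis tau_n : (tau <= n)%N.
Hypothesis long_stack : forall u : nat, (u <= tau)%N ->
  eta * (tau%:R - u%:R) <= u%:R - kap%:R + xs -> (2 * kap <= u)%N.
Hypothesis early_push : forall m : nat,
  eta * (m%:R - (2 * kap)%:R) <= (2 * kap)%:R - kap%:R + xs -> (2 * m <= tau)%N.

Lemma Pr_sat_upper : Pr (fun=> q) (@satisfiable n) <=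
  2 * gam + 2 * (1 - p2) ^+ 'C(uphalf tau, 2).
Proof.
have prob (e : R) : 0 <= e <= 1 -> is_prob (fun _ : clause n => e) by move=> ? ?.
have [p0 p1] := andP p01; have [p20 p21] := andP p201.
have r01 : 0 <= p + p2 - p * p2 <= 1 by apply/andP; split; nra.
have le1 : Pr (fun=> q) (@satisfiable n) <= Pr (fun=> p + p2 - p * p2) (@satisfiable n).
  have eN w : - Pr w (@satisfiable n) = Ex w (fun F => - (satisfiable F)%:R).
    by rewrite -mulN1r -ExZ; apply: eq_Ex => // F; rewrite mulN1r.
  rewrite -lerN2 !eN; apply: (Ex_mono_weight (prob _ r01) (prob _ q01) sat_mono_neg).
  by move=> i; apply: le_trans hpq; rewrite gerBl mulr_ge0.
apply: le_trans le1 _.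
rewrite /Pr (Ex_two_rounds (w1 := fun=> p) (fun=> p2)); last exact: prob.
set B := fun F => bad (roots1 kap) theta p gam (end1 theta p gam tau kap F) ||
  bad (roots2 kap (end1 theta p gam tau kap F)) theta p gam
    (end2 theta p gam tau kap (end1 theta p gam tau kap F) F).
set d := 2 * (1 - p2) ^+ _.
have PB : Pr (fun=> p) B <= gam + gam.
  exact: (Pr_two_searches tau kap p01 theta01 gam0 (prob _ p01) (fun=> erefl)).
have d0 : 0 <= d by rewrite mulr_ge0 // exprn_ge0 // subr_ge0.
apply: le_trans (_ : Ex (fun=> p) (fun F => (B F)%:R + d) <= _); last first.
  by rewrite ExD Ex_cst lerD2r mulr2n mulrDl !mul1r.
apply: le_Ex; first exact: prob.
move=> F; case bF : (B F) => /=.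
  apply: (@le_trans _ _ 1); last by rewrite lerDl.
  exact: Pr_le1 (prob _ p201).
have [r /andP[h1 h2]] := two_searches eta0 search xs_lt kap_gt0 kap_tau tau_n long_stack early_push (negbT bF).
rewrite add0r; apply: le_trans (le_Pr (prob _ p201) (fun F2 => @sat_blockers F F2 r)) _.
apply: le_trans (Pr_or _ _ (prob _ p201)) _.
have blk s : (tau <= 2 * #|vreach F s|)%N ->
    Pr (fun=> p2) (fun F2 => [disjoint blockers F s & F2]) <= (1 - p2) ^+ 'C(uphalf tau, 2).
  move=> hs; rewrite Pr_avoid prodr_const; apply: ler_wiXn2l.
  - by rewrite subr_ge0.
  - by rewrite lerBlDl lerDr.
  - apply: leq_trans (card_blockers F s); apply: leq_bin2l.
    by rewrite leq_uphalf_double -mul2n.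
by rewrite /d mulr2n mulrDl mul1r; apply: lerD; exact: blk.
Qed.

End UpperBound.

(** * Asymptotics *)

Section ExponentialBounds.
Context {R : realType}.
Implicit Types (n : nat) (p sigma : R).

Lemma card_clause n : (#|{: clause n}| <= (2 * n) ^ 2)%N.
Proof.
have <- : #|{: literal n * literal n}| = ((2 * n) ^ 2)%N.
  by rewrite !card_prod card_ord card_bool [(n * 2)%N]mulnC -mulnn.
pose f (yz : literal n * literal n) : {set literal n} := [set yz.1; yz.2].
apply: leq_trans (leq_imset_card f _).
rewrite -(card_imset _ (val_inj : injective (val : clause n -> _))).
apply: subset_leq_card; apply/subsetP => _ /imsetP[c _ ->].
have [y [z [_ e]]] := clause_var c.
by apply/imsetP; exists (y, z).
Qed.

Lemma expR_le_1B (d : R) : 0 <= d <= 2^-1 -> expR (- (2 * d)) <= 1 - d.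
Proof.
move=> /andP[d0 d1]; rewrite expRN; have h := expR_ge1Dx (2 * d).
have e0 : 0 < expR (2 * d) := expR_gt0 _.
rewrite -div1r ler_pdivrMr //; nra.
Qed.

Lemma expRX_ge (d : R) m : 0 <= d <= 2^-1 -> expR (- (2 * d * m%:R)) <= (1 - d) ^+ m.
Proof.
move=> d01; rewrite -mulNr expRM_natr lerXn2r ?nnegrE ?expR_ge0 ?expR_le_1B //.
by have /andP[? ?] := d01; lra.
Qed.

(** 122 = 1 + 11^2: in [Pr_spine2_le] the hitting term is at most sigma^2 [expR 2] and the survival
    bound at most (8 + 3) sigma [expR 2], where [expR 2] bounds lam^k. *)
Definition spine_const : R := 122 * expR 2 ^+ 2.

Lemma expR2_ge1 : 1 <= expR 2 :> R.
Proof. by have := expR_ge1Dx (2 : R); lra. Qed.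

Lemma spine_const_ge1 : 1 <= spine_const.
Proof.
have h : 1 <= expR 2 ^+ 2 :> R by rewrite exprn_ege1 // expR2_ge1.
by move: h; rewrite /spine_const; clear; lra.
Qed.

Lemma Pr_spine2_le n p sigma (w : clause n -> R) x y : is_prob w ->
  (forall c, w c <= p) -> x.1 != y.1 -> 0 <= p <= 2^-1 -> 0 < sigma ->
  p * (2 * n%:R - 1) = 1 + sigma -> 4 <= sigma ^+ 3 * n%:R -> 1 <= n%:R :> R ->
  Pr w (fun F => spine F x && spine F y) <= spine_const * sigma ^+ 2.
Proof.
move=> pw wp xy p02 s0 ps sn n1; have [p0 p2] := andP p02.
have E1 := expR2_ge1.
have [s1|s1] := leP 1 sigma.
  apply: le_trans (Pr_le1 _ pw) _; apply: mulr_ege1; first exact: spine_const_ge1.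
  exact: exprn_ege1.
set k := Num.truncn sigma^-1.
have /andP[k1 k2] : k%:R <= sigma^-1 < k.+1%:R by apply: truncn_itv; rewrite invr_ge0 ltW.
have is1 : 1 <= sigma^-1 by rewrite invf_ge1 // ltW.
have k3 : 1 <= k%:R :> R.
  by rewrite (_ : 1 = 1%:R) // ler_nat truncn_ge_nat // (le_trans ler01).
have ks1 : k%:R * sigma <= 1 by rewrite -ler_pdivlMr // div1r.
have ks2 : 2^-1 <= k%:R * sigma.
  have : 1 < (k%:R + 1) * sigma by rewrite -ltr_pdivrMr // div1r natr1.
  nra.
have pn : p * n%:R <= 2 by nra.
(* The lower bound on sigma^3 n enters here: with k at most 1 / sigma it makes the closing-up term
   k^2 p of order sigma. *)
have ps3 : p <= sigma ^+ 3 / 2.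
  have : p * n%:R <= sigma ^+ 3 / 2 * n%:R by lra.
  by rewrite ler_pM2r // (lt_le_trans ltr01).
have s3 : 0 < sigma ^+ 3 by rewrite exprn_gt0.
have s2 : 0 < sigma ^+ 2 by rewrite exprn_gt0.
have s31 : sigma ^+ 3 <= sigma ^+ 2 by rewrite !exprS expr0; nra.
have s21 : sigma ^+ 2 <= sigma by rewrite expr2; nra.
have elam : (2 * n)%:R * p = 1 + sigma + p by rewrite natrM; lra.
have lam1 : 1 <= (2 * n)%:R * p by rewrite elam; lra.
have lamk : ((2 * n)%:R * p) ^+ k <= expR 2.
  have h : (2 * n)%:R * p <= expR (2 * sigma).
    by apply: le_trans (expR_ge1Dx _); rewrite elam; lra.
  apply: le_trans (_ : expR (2 * sigma) ^+ k <= _).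
    by rewrite lerXn2r ?nnegrE ?expR_ge0 //; lra.
  by rewrite -expRM_natr ler_expR; nra.
have := Pr_spine2 k pw p02 lam1 wp xy.
rewrite /survival_bound natrD [(4 * k)%:R]natrM.
have L0 : 0 <= ((2 * n)%:R * p) ^+ k by rewrite exprn_ge0 //; lra.
move: lamk L0; set L := _ ^+ k => lamk L0.
set K := k%:R in k3 ks1 ks2 *.
have h1 : K * 2 * p <= sigma ^+ 2.
  have : K * p <= K * (sigma ^+ 3 / 2) by rewrite ler_wpM2l //; lra.
  rewrite exprS; nra.
have h1' : K * 2 * p * L <= sigma ^+ 2 * expR 2.
  by apply: ler_pM => //; rewrite !mulr_ge0 //; lra.
have h2 : 4 * L / (K + 4) <= 8 * sigma * expR 2.
  rewrite ler_pdivrMr; last lra.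
  have : 4 <= 8 * sigma * (K + 4) by nra.
  nra.
have h3 : K * (4 * K + 2) * p * L <= 3 * sigma * expR 2.
  apply: ler_pM => //; first by rewrite !mulr_ge0 //; lra.
  have e1 : K * (4 * K + 2) <= 6 * (K * K) by nra.
  have e2 : (K * sigma) * (K * sigma) <= 1 by nra.
  have e3 : K * (4 * K + 2) * p <= 6 * (K * K) * (sigma ^+ 3 / 2).
    by apply: ler_pM => //; rewrite mulr_ge0 //; lra.
  apply: le_trans e3 _; have : 3 * sigma * ((K * sigma) * (K * sigma)) <= 3 * sigma by nra.
  by rewrite exprS expr2; lra.
move=> H; apply: (le_trans H).
have h4 : 4 * L / (K + 4) + K * (4 * K + 2) * p * L <= 11 * sigma * expR 2 by lra.
have h40 : 0 <= 4 * L / (K + 4) + K * (4 * K + 2) * p * L.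
  rewrite addr_ge0 ?divr_ge0 ?mulr_ge0 //; lra.
have h5 : (4 * L / (K + 4) + K * (4 * K + 2) * p * L) ^+ 2 <= (11 * sigma * expR 2) ^+ 2.
  by rewrite lerXn2r ?nnegrE // (le_trans h40).
apply: le_trans (lerD h1' h5) _; rewrite /spine_const !exprMn.
have EE : expR 2 <= expR 2 ^+ 2 :> R by apply: ler_eXnr.
have : sigma ^+ 2 * expR 2 <= sigma ^+ 2 * expR 2 ^+ 2 by exact: ler_wpM2l (ltW s2) _ _ EE.
by lra.
Qed.

(** In the exponent, 8 = 2 * 4 comes from 1 - d >= exp(- 2 d) and at most 4 n^2 clauses, 3 + M from
    the distance between p and the subcritical start, and the last 1 pays for the initial
    probability 1/2. *)
Lemma Pr_sat_lower n p sigma (M : R) : 0 <= p <= 1 ->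
  p * (2 * n%:R - 1) = 1 + sigma -> 0 < sigma <= M ->
  4 <= sigma ^+ 3 * n%:R -> 32 <= n%:R :> R -> 4 * (1 + M) <= n%:R ->
  4 * (3 + M) * spine_const * M ^+ 3 <= n%:R ->
  expR (- ((8 * (3 + M) * spine_const + 1) * (sigma ^+ 3 * n%:R))) <=
    Pr (fun=> p) (@satisfiable n).
Proof.
move=> p01 ps /andP[s0 sM] sn n32 nM nC; have [p0 p1] := andP p01.
have n0 : 0 < n%:R :> R by lra.
have C1 := spine_const_ge1.
have pn : p * n%:R <= 1 + M by nra.
have p4 : p <= 4^-1.
  have : p * n%:R <= 4^-1 * n%:R by lra.
  by rewrite ler_pM2r.
have s3 : 0 < sigma ^+ 3 by rewrite exprn_gt0.
have ns : 1 <= sigma * n%:R.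
  have [s1|s1] := leP 1 sigma; first by nra.
  have : sigma ^+ 3 <= sigma by rewrite !exprS expr0; nra.
  nra.
(* sigma may exceed 1, whereas the subcritical density 1 - eps has to stay nonnegative. *)
pose eps := Num.min sigma 2^-1.
have eps0 : 0 < eps by rewrite lt_min s0 invr_gt0 ltr0n.
have eps2 : eps <= 2^-1 by rewrite ge_min lexx orbT.
have epss : eps <= sigma by rewrite ge_min lexx.
pose p0' := (1 - eps) / (2 * n)%:R.
have nn0 : 0 < (2 * n)%:R :> R by rewrite natrM; lra.
have p0'0 : 0 <= p0' by rewrite divr_ge0 ?ltW //; lra.
have ep0 : (2 * n)%:R * p0' = 1 - eps by rewrite mulrC divfK ?gt_eqF.
clearbody p0'.
have ep : (2 * n)%:R * p = 1 + sigma + p by rewrite natrM; lra.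
have p0p : p0' <= p by rewrite -(ler_pM2l nn0) ep0 ep; lra.
have dp : (p - p0') * n%:R <= (3 + M) / 2 * sigma.
  have : (2 * n)%:R * (p - p0') = sigma + eps + p by rewrite mulrBr ep0 ep; lra.
  rewrite natrM => h; have : p <= (1 + M) * sigma.
    have : p * n%:R <= (1 + M) * sigma * n%:R by nra.
    by rewrite ler_pM2r.
  lra.
have base : 2^-1 <= Pr (fun=> p0') (@satisfiable n).
  have p0'01 : 0 <= p0' <= 1 by rewrite p0'0 (le_trans p0p).
  have pp0 : is_prob (fun _ : clause n => p0') by [].
  have e01 : 0 < eps <= 1 by rewrite eps0; move: eps2; clear; lra.
  have := Pr_unsat_subcritical pp0 p0'01 (_ : _ <= 1 - eps) e01 (fun=> lexx _).
  rewrite ep0 lexx => /(_ isT); rewrite -[X in X <= _ -> _]/(Pr _ (predC _)) PrC.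
  have e3 : 4 <= eps ^+ 3 * n%:R.
    rewrite /eps minEle; case: ifP => _ //; rewrite !exprS expr0; lra.
  have e30 : 0 < eps ^+ 3 by rewrite exprn_gt0.
  have : (2 * n)%:R * (p0' ^+ 2 * (4 / eps ^+ 3)) <= 2^-1; last by lra.
  rewrite expr2 !mulrA ep0 ler_pdivrMr // .
  have : p0' * (2 * n)%:R <= 1 by rewrite mulrC ep0; lra.
  rewrite natrM => h.
  have h' : p0' * 4 <= 2^-1 * eps ^+ 3.
    have : p0' * 4 * n%:R <= 2^-1 * eps ^+ 3 * n%:R by lra.
    by rewrite ler_pM2r.
  nra.
have Cs0 : 0 <= spine_const * sigma ^+ 2.
  by apply: mulr_ge0; [move: C1; clear; lra | rewrite exprn_ge0 // ltW].
have dC : (p - p0') * (spine_const * sigma ^+ 2 / (1 - p)) <=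
    (3 + M) * spine_const * sigma ^+ 3 / n%:R.
  have i2 : spine_const * sigma ^+ 2 / (1 - p) <= 2 * (spine_const * sigma ^+ 2).
    by rewrite ler_pdivrMr; nra.
  rewrite ler_pdivlMr //.
  apply: le_trans (_ : (p - p0') * (2 * (spine_const * sigma ^+ 2)) * n%:R <= _).
    by rewrite ler_wpM2r ?ler_wpM2l ?subr_ge0 // ltW.
  have : (p - p0') * n%:R * (2 * (spine_const * sigma ^+ 2)) <=
      (3 + M) / 2 * sigma * (2 * (spine_const * sigma ^+ 2)).
    by rewrite ler_wpM2r //; lra.
  by rewrite [sigma ^+ 3]exprS; lra.
have dC2 : (3 + M) * spine_const * sigma ^+ 3 / n%:R <= 4^-1.
  rewrite ler_pdivrMr //.
  have : sigma ^+ 3 <= M ^+ 3 by rewrite lerXn2r ?nnegrE ?(ltW s0) // (le_trans (ltW s0)).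
  have : 0 <= (3 + M) * spine_const by nra.
  nra.
have d0 : 0 <= (p - p0') * (spine_const * sigma ^+ 2 / (1 - p)).
  by rewrite mulr_ge0 ?subr_ge0 // divr_ge0 // subr_ge0.
have n1 : 1 <= n%:R :> R by move: n32; clear; lra.
have p02 : 0 <= p <= 2^-1 by rewrite p0 /=; move: p4; clear; lra.
have hpi (w' : clause n -> R) (x y : literal n) : is_prob w' -> (forall c, w' c <= p) -> x.1 != y.1 ->
    Pr w' (fun F => spine F x && spine F y) <= spine_const * sigma ^+ 2.
  by move=> pw' wp' xy; have := Pr_spine2_le pw' wp' xy p02 s0 ps sn n1.
have p0'p : 0 <= p0' <= p by rewrite p0'0.
have p1' : p < 1 by move: p4; clear; lra.
have d1 : (p - p0') * (spine_const * sigma ^+ 2 / (1 - p)) <= 1.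
  by apply: (le_trans dC); apply: (le_trans dC2); clear; lra.
apply: le_trans (Pr_sat_ratio p0'p p1' d1 hpi Cs0).
move: d0 d1 dC; set d := (p - p0') * _ => d0 d1 dC.
have dm : expR (- (2 * d * #|{: clause n}|%:R)) <= (1 - d) ^+ #|{: clause n}|.
  by apply: expRX_ge; rewrite d0 /=; move: dC dC2; clear; lra.
have half : expR (- (sigma ^+ 3 * n%:R)) <= 2^-1.
  rewrite expRN lef_pV2 ?posrE ?expR_gt0 //.
  by apply: (le_trans _ (expR_ge1Dx _)); move: sn; clear; lra.
rewrite mulrDl mul1r opprD expRD; apply: ler_pM; rewrite ?expR_ge0 //; last exact: le_trans base.
apply: le_trans dm; rewrite ler_expR lerN2.
have cN : #|{: clause n}|%:R <= 4 * n%:R ^+ 2 :> R.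
  have := card_clause n; rewrite -(ler_nat R) => h; apply: le_trans h _.
  by rewrite natrX natrM (_ : (2 * n%:R) ^+ 2 = 4 * n%:R ^+ 2) //; ring.
apply: le_trans (_ : 2 * ((3 + M) * spine_const * sigma ^+ 3 / n%:R) * (4 * n%:R ^+ 2) <= _).
  by apply: ler_pM => //; [rewrite mulr_ge0|rewrite ler_pM2l].
rewrite le_eqVlt; apply/orP; left; apply/eqP; field.
by rewrite gt_eqF.
Qed.

End ExponentialBounds.

(** * Choice of parameters for the two searches *)

Section UpperExponentialBound.
Context {R : realType}.
Implicit Types (n : nat) (p : R).

(* The bound on the potential forces, up to lower order terms,
   s >= (1 - theta) p t - L / theta, while p t is at least about (1 + e) d. *)
Lemma search_estimate (theta p L e : R) (n tau s t d : nat) :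
  0 < e <= 2^-1 -> theta = e / 4 -> (2 * n)%:R * p = 1 + e -> 16 <= n%:R :> R ->
  16 * tau%:R <= e * n%:R -> 0 <= L ->
  expR (- L) * (1 - theta) ^+ s * (1 + theta * p) ^+ t < 1 ->
  (d * (2 * (n - 3 * tau)) <= t)%N ->
  (1 + e / 4) * d%:R <= s%:R + L / theta.
Proof.
move=> /andP[e0 e2] eth ep n16 htau L0 hgood hd.
have th0 : 0 < theta by rewrite eth; lra.
have th8 : theta <= 8^-1 by rewrite eth; lra.
have n0 : 0 < n%:R :> R by lra.
have p0 : 0 < p.
  have : 0 < (2 * n)%:R * p by rewrite ep; lra.
  by rewrite pmulr_rgt0 // natrM; lra.
have p16 : p <= 16^-1.
  have h : p * n%:R <= 1 by move: ep; rewrite natrM; lra.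
  have : p * 16 <= p * n%:R by rewrite ler_wpM2l // ltW.
  lra.
have l1 : expR (- (theta / (1 - theta))) <= 1 - theta.
  have h := expR_ge1Dx (theta / (1 - theta)).
  rewrite expRN -div1r ler_pdivrMr ?expR_gt0 //.
  have q0 : 0 < 1 - theta by lra.
  have : (1 - theta) * (1 + theta / (1 - theta)) = 1 by field; rewrite gt_eqF.
  have : (1 - theta) * (1 + theta / (1 - theta)) <= (1 - theta) * expR (theta / (1 - theta)).
    by rewrite ler_wpM2l // ltW.
  lra.
have tp0 : 0 < theta * p by rewrite mulr_gt0.
have l2 : expR (theta * p / (1 + theta * p)) <= 1 + theta * p.
  have h := expR_ge1Dx (- (theta * p / (1 + theta * p))).
  have q0 : 0 < 1 + theta * p by lra.
  have EE : expR (theta * p / (1 + theta * p)) * expR (- (theta * p / (1 + theta * p))) = 1.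
    by rewrite -expRD subrr expR0.
  have r : (1 + theta * p) * (1 - theta * p / (1 + theta * p)) = 1 by field; rewrite gt_eqF.
  have e0' := expR_gt0 (theta * p / (1 + theta * p)).
  move: h EE r e0'; set X := _ / _; set E := expR X; set E' := expR _ => h EE r e0'.
  have : (1 + theta * p) * E * (1 - X) <= (1 + theta * p) * E * E'.
    by apply: ler_wpM2l h; apply: mulr_ge0; apply: ltW.
  by rewrite -mulrA [E * (1 - X)]mulrC mulrA r mul1r -mulrA EE mulr1.
have key : - L - theta / (1 - theta) * s%:R + theta * p / (1 + theta * p) * t%:R < 0.
  rewrite -(ltr_expR) expR0; apply: le_lt_trans hgood.
  rewrite !expRD -mulNr !expRM_natr; apply: ler_pM.
  - by rewrite mulr_ge0 ?exprn_ge0 ?expR_ge0.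
  - by rewrite exprn_ge0 ?expR_ge0.
  - by rewrite ler_wpM2l ?expR_ge0 // lerXn2r ?nnegrE ?expR_ge0 //; lra.
  - by rewrite lerXn2r ?nnegrE ?expR_ge0 //; lra.
have hd' : d%:R * (2 * (n%:R - 3 * tau%:R)) <= t%:R :> R.
  have tn : (3 * tau <= n)%N by rewrite -(ler_nat R) natrM; nra.
  by rewrite -(ler_nat R) natrM natrM natrB // natrM in hd.
have A : (1 + e / 4) * d%:R <= (1 - theta) * (p / (1 + theta * p) * t%:R).
  have a1 : 2 * p * (n%:R - 3 * tau%:R) >= (1 + e) * (1 - 3 * e / 16).
    have : 2 * p * (n%:R * (1 - 3 * e / 16)) <= 2 * p * (n%:R - 3 * tau%:R).
      by rewrite ler_wpM2l //; lra.
    have -> : 2 * p * (n%:R * (1 - 3 * e / 16)) = (2 * n)%:R * p * (1 - 3 * e / 16).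
      by rewrite natrM; ring.
    by rewrite ep.
  have tpe : theta * p <= e / 64 by rewrite eth; nra.
  have a2 : 1 + e / 4 <= (1 - theta) * ((1 + e) * (1 - 3 * e / 16)) / (1 + theta * p).
    rewrite ler_pdivlMr; last by lra.
    apply: le_trans (_ : (1 + e / 4) * (1 + e / 64) <= _).
      by rewrite ler_wpM2l //; lra.
    rewrite eth.
    have b1 : 1 + 5 / 8 * e <= (1 - e / 4) * (1 + e) by nra.
    have b2 : (1 + 5 / 8 * e) * (1 - 3 * e / 16) <= (1 - e / 4) * (1 + e) * (1 - 3 * e / 16).
      by rewrite ler_wpM2r //; lra.
    have b3 : 1 + 3 / 8 * e <= (1 + 5 / 8 * e) * (1 - 3 * e / 16) by nra.
    have b4 : (1 + e / 4) * (1 + e / 64) <= 1 + 3 / 8 * e by nra.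
    by rewrite mulrA; lra.
  apply: le_trans (ler_wpM2r _ a2) _ => //.
  have q0 : 0 < 1 + theta * p by lra.
  rewrite [leLHS](_ : _ = (1 - theta) / (1 + theta * p) * ((1 + e) * (1 - 3 * e / 16) * d%:R)); last by ring.
  rewrite [leRHS](_ : _ = (1 - theta) / (1 + theta * p) * (p * t%:R)); last by ring.
  rewrite ler_wpM2l ?divr_ge0 //; [lra|exact: ltW|].
  apply: le_trans (ler_wpM2r _ a1) _ => //.
  have : p * (d%:R * (2 * (n%:R - 3 * tau%:R))) <= p * t%:R by rewrite ler_wpM2l // ltW.
  lra.
apply: le_trans A _.
have q0 : 0 < 1 - theta by lra.
have k2 : p / (1 + theta * p) * t%:R <= (L + theta / (1 - theta) * s%:R) / theta.
  rewrite ler_pdivlMr //; lra.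
apply: le_trans (ler_wpM2l (ltW q0) k2) _.
rewrite [leLHS](_ : _ = s%:R + (1 - theta) * (L / theta)); last first.
  by field; rewrite !gt_eqF.
rewrite lerD2l ler_piMl ?divr_ge0 //; [exact: ltW | lra].
Qed.


(** tau, about e n / 16, is small enough to keep the search supercritical after tau touched
    variables; kap, about e^2 n / 400, is well below eta tau = e^2 n / 64, as [long] and [early]
    need. With theta = eta = e / 4 the deficit kap / 2 costs exp(- theta kap / 2), of order e^3 n in
    the exponent. *)
Lemma Pr_sat_exp_upper_aux n (p q p2 e : R) (tau kap : nat) :
  0 < e <= 2^-1 -> (2 * n)%:R * q = 1 + e -> (2 * n)%:R * p2 = e ->
  q + p2 <= p -> p <= 1 ->
  16 * tau%:R <= e * n%:R < 16 * (tau%:R + 1) ->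
  400 * kap%:R <= e * (e * n%:R) < 400 * (kap%:R + 1) ->
  1024 * 4 <= e * (e * n%:R) ->
  Pr (fun=> p) (@satisfiable n) <= 4 * expR (- (e ^+ 3 * n%:R / (1024 * 16))).
Proof.
move=> e02 eq ep2 hpq p1 /andP[t1 t2] /andP[k1 k2] big; have [e0 e2] := andP e02.
have en : e * (e * n%:R) <= 2^-1 * (e * n%:R).
  apply: ler_wpM2r e2; rewrite -(pmulr_rge0 _ e0); move: big; clear; lra.
have n0 : 0 < n%:R :> R.
  rewrite -(pmulr_rgt0 _ e0); move: big en; clear; lra.
have nn0 : 0 < (2 * n)%:R :> R by rewrite natrM mulr_gt0.
have q0 : 0 < q by rewrite -(pmulr_rgt0 _ nn0) eq; move: e0; clear; lra.
have p20 : 0 < p2 by rewrite -(pmulr_rgt0 _ nn0) ep2.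
have q01 : 0 <= q <= 1 by rewrite ltW //=; move: hpq p1 p20; clear; lra.
have p201 : 0 <= p2 <= 1 by rewrite ltW //=; move: hpq p1 q0; clear; lra.
have p01 : 0 <= p <= 1 by rewrite p1 andbT; move: hpq p20 q0; clear; lra.
have theta01 : 0 <= e / 4 <= 1 by move: e0 e2; clear => *; apply/andP; split; lra.
have th0 : 0 < e / 4 by move: e0; clear; lra.
have L0 : 0 <= e / 4 * (kap%:R / 2) by rewrite mulr_ge0 ?divr_ge0 // ltW.
have n16 : 16 <= n%:R :> R.
  have : e * n%:R <= 2^-1 * n%:R by rewrite ler_pM2r.
  move: big en; clear; lra.
have search sq t d : expR (- (e / 4 * (kap%:R / 2))) * (1 - e / 4) ^+ sq *
    (1 + e / 4 * q) ^+ t < 1 ->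
    (d * (2 * (n - 3 * tau)) <= t)%N -> (1 + e / 4) * d%:R <= sq%:R + kap%:R / 2.
  rewrite -[kap%:R / 2 in leRHS](mulKf (lt0r_neq0 th0)) [(e / 4)^-1 * _]mulrC.
  exact: (search_estimate e02 erefl eq n16 t1 L0).
have kapR : 9 < kap%:R :> R by move: k2 big; clear; lra.
have xs_lt : kap%:R / 2 < kap%:R :> R by move: kapR; clear; lra.
have kap0 : (0 < kap)%N by rewrite -(ltr_nat R); move: kapR; clear; lra.
have kap_tau : (kap <= tau)%N by rewrite -(ler_nat R); move: kapR k1 t2 en; clear; lra.
have tau_n : (tau <= n)%N.
  rewrite -(ler_nat R); have : e * n%:R <= 2^-1 * n%:R by rewrite ler_pM2r.
  move: t1 n0; clear; lra.
have eT : e * (e * n%:R) <= e * (16 * (tau%:R + 1)) by rewrite ler_wpM2l // ltW.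
have long u : (u <= tau)%N ->
    e / 4 * (tau%:R - u%:R) <= u%:R - kap%:R + kap%:R / 2 -> (2 * kap <= u)%N.
  move=> ut h; rewrite leqNgt; apply/negP => uk.
  have h1 : u%:R + 1 <= 2 * kap%:R :> R by rewrite natr1 -natrM ler_nat.
  have h2 : e * u%:R <= 2^-1 * u%:R by rewrite ler_wpM2r.
  move: eT h h1 h2 k1 e2 big; clear; lra.
have early m : e / 4 * (m%:R - (2 * kap)%:R) <= (2 * kap)%:R - kap%:R + kap%:R / 2 ->
    (2 * m <= tau)%N.
  rewrite natrM => h; rewrite -(ler_nat R) natrM.
  have h2 : e * kap%:R <= 2^-1 * kap%:R by rewrite ler_wpM2r.
  rewrite -(ler_pM2l e0); move: eT h h2 k1 e2 big; clear; lra.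
have main := Pr_sat_upper q01 theta01 (expR_ge0 _) p201 p01 hpq th0 search xs_lt
  kap0 kap_tau tau_n long early.
apply: (le_trans main).
have eY : e ^+ 3 * n%:R = e * (e * (e * n%:R)) by ring.
have eL : expR (- (e / 4 * (kap%:R / 2))) <= expR (- (e ^+ 3 * n%:R / (1024 * 16))).
  rewrite ler_expR lerN2 eY.
  have : e * (e * (e * n%:R)) <= e * (400 * (kap%:R + 1)) by rewrite ler_wpM2l ?ltW.
  have : e * 9 <= e * kap%:R by rewrite ler_wpM2l ?ltW.
  move: e0; clear; lra.
(* This term fixes 1024 * 16: there are at least (e n / 64)^2 / 2 blockers, each of probability e /
   (2 n). *)
have eS : (1 - p2) ^+ 'C(uphalf tau, 2) <= expR (- (e ^+ 3 * n%:R / (1024 * 16))).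
  have h1 : 1 - p2 <= expR (- p2) by apply: expR_ge1Dx.
  have [_ p21] := andP p201.
  apply: le_trans (_ : expR (- p2) ^+ 'C(uphalf tau, 2) <= _).
    by rewrite lerXn2r ?nnegrE ?expR_ge0 // subr_ge0.
  rewrite -expRM_natr ler_expR mulNr lerN2.
  set m := uphalf tau.
  have mT : tau%:R <= 2 * m%:R :> R by rewrite -natrM ler_nat mul2n -leq_uphalf_double.
  have bin : ('C(m, 2))%:R * 2 = m%:R * (m%:R - 1) :> R.
    rewrite -natrM mulnC -mul_bin_diag bin1 natrM; case: (m) => [|m']; first by rewrite !mul0r.
    by rewrite -natr1 addrK.
  have m64 : e * n%:R / 64 <= m%:R - 1 by move: mT t2 en big; clear; lra.
  have m64' : 0 <= e * n%:R / 64 by rewrite divr_ge0 // mulr_ge0 // ltW.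
  have mm : (e * n%:R / 64) * (e * n%:R / 64) <= m%:R * (m%:R - 1).
    by apply: ler_pM => //; move: m64; clear; lra.
  have : p2 * ((e * n%:R / 64) * (e * n%:R / 64)) <= p2 * (m%:R * (m%:R - 1)) by rewrite ler_wpM2l // ltW.
  rewrite -bin.
  have -> : p2 * ((e * n%:R / 64) * (e * n%:R / 64)) = (2 * n)%:R * p2 * (e * (e * n%:R)) / (1024 * 8).
    by rewrite natrM; field.
  rewrite ep2 eY; clear; lra.
move: eL eS; clear; lra.
Qed.

Lemma Pr_sat_exp_upper n p (s : R) : 0 < s <= 1 -> p <= 1 ->
  1 + s <= (2 * n)%:R * p -> 1024 * 1024 <= s ^+ 3 * n%:R ->
  Pr (fun=> p) (@satisfiable n) <= expR (- (s ^+ 3 * n%:R / (256 * 1024))).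
Proof.
move=> /andP[s0 s1] p1 hp hs.
have n0 : 0 < n%:R :> R.
  have : 0 < s ^+ 3 * n%:R by move: hs; clear; lra.
  by rewrite pmulr_rgt0 ?exprn_gt0.
have nn0 : 0 < (2 * n)%:R :> R by rewrite natrM mulr_gt0.
(* The excess s is shared equally: densities 1 + e for the search and e for the second round. *)
have [e es] : exists e, s = 2 * e by exists (s / 2); field.
have e02 : 0 < e <= 2^-1 by move: s0 s1; rewrite es; clear => *; apply/andP; split; lra.
have [e0 e2] := andP e02.
have big : 1024 * 4 <= e * (e * n%:R).
  have : s ^+ 3 * n%:R <= s ^+ 2 * n%:R by rewrite ler_wpM2r ?(ltW n0) // exprS ler_piMl ?exprn_ge0 // ltW.
  have -> : s ^+ 2 * n%:R = 4 * (e * (e * n%:R)) by rewrite es; ring.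
  move: hs; clear; lra.
have tI : 0 <= e * n%:R / 16 by rewrite divr_ge0 // mulr_ge0 // ltW.
have kI : 0 <= e * (e * n%:R) / 400.
  by move: big; clear; lra.
have t := truncn_itv tI; have k := truncn_itv kI.
move: t k; set tau := Num.truncn _; set kap := Num.truncn _; clearbody tau kap.
rewrite -[tau.+1%:R]natr1 -[kap.+1%:R]natr1 => /andP[t1 t2] /andP[k1 k2].
apply: le_trans (_ : 4 * expR (- (e ^+ 3 * n%:R / (1024 * 16))) <= _).
  apply: (@Pr_sat_exp_upper_aux n p ((1 + e) / (2 * n)%:R) (e / (2 * n)%:R) e tau kap) => //.
  - by rewrite mulrC divfK ?gt_eqF.
  - by rewrite mulrC divfK ?gt_eqF.
  - by rewrite -mulrDl ler_pdivrMr // mulrC; move: hp; rewrite es; clear; lra.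
  - by move: t1 t2; clear => *; apply/andP; split; lra.
  - by move: k1 k2; clear => *; apply/andP; split; lra.
(* Half of the exponent absorbs the factor 4, as it is at least 1024 * 1024 / (256 * 1024) = 4. *)
have -> : e ^+ 3 * n%:R / (1024 * 16) = s ^+ 3 * n%:R / (256 * 1024) + s ^+ 3 * n%:R / (256 * 1024).
  by rewrite es; field.
move: hs; set Y := s ^+ 3 * n%:R; move: (Y) => {}Y hs.
set E := expR (- (Y / (256 * 1024))).
have E4 : 4 * E <= 1.
  have h := expR_ge1Dx (Y / (256 * 1024)).
  rewrite /E expRN ler_pdivrMr ?expR_gt0 // mul1r; apply: le_trans h; move: hs; clear; lra.
have E0 : 0 <= E := expR_ge0 _.
rewrite opprD expRD -/E; have := ler_wpM2r E0 E4; clear; lra.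
Qed.

End UpperExponentialBound.

Lemma Pr_formulaE (R : realType) n (p : R) (E : pred (formula n)) :
  Pr_formula p E = Pr (fun=> p) E.
Proof.
rewrite /Pr_formula /Pr /Ex big_mkcond; apply: eq_bigr => F _.
by case: (E F); rewrite /weight ?mulr1 ?mulr0.
Qed.

Lemma Pr_sat_two_sided (R : realType) (M : R) : 0 <= M ->
  exists c C A : R, [/\ 0 < c, 0 < C & forall n (p sigma : R), 0 <= p <= 1 ->
    p * (2 * n%:R - 1) = 1 + sigma -> 0 < sigma <= M ->
    A <= sigma ^+ 3 * n%:R -> A <= n%:R ->
    expR (- (C * (sigma ^+ 3 * n%:R))) <= Pr (fun=> p) (@satisfiable n) <=
    expR (- (c * (sigma ^+ 3 * n%:R)))].
Proof.
move=> M0; have C0 : 0 <= spine_const :> R.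
  by apply: mulr_ge0; [lra | rewrite exprn_ge0 // expR_ge0].
have M3 : 0 <= 3 + M by lra.
have D0 : 0 < (1 + M) ^+ 3 by rewrite exprn_gt0 // ltr_pwDl.
exists ((1 + M) ^+ 3 * (256 * 1024))^-1, (8 * (3 + M) * spine_const + 1).
exists (1024 * 1024 + 4 * (1 + M) + 4 * (3 + M) * spine_const * M ^+ 3); split.
- by rewrite invr_gt0; apply: mulr_gt0 D0 _; lra.
- by rewrite ltr_wpDl // mulr_ge0 // mulr_ge0.
move=> n p sigma p01 ps /andP[s0 sM] An1 An2.
have x0 : 0 <= 4 * (3 + M) * spine_const * M ^+ 3 by apply: mulr_ge0; rewrite ?exprn_ge0 // mulr_ge0 // mulr_ge0.
have y0 : 0 <= 4 * (1 + M) by rewrite mulr_ge0 // addr_ge0.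
apply/andP; split.
  apply: (Pr_sat_lower p01 ps).
  - by rewrite s0.
  - by move: An1 x0 y0; clear; lra.
  - by move: An2 x0 y0; clear; lra.
  - by move: An2 x0 y0; clear; lra.
  - by move: An2 x0 y0; clear; lra.
(* The search argument needs an excess at most 1 and only a lower bound on the density; as
   [sigma <= s * (1 + M)], truncating costs (1 + M)^3 in the constant. *)
pose s := Num.min sigma 1.
have s01 : 0 < s <= 1 by rewrite lt_min s0 ltr01 ge_min lexx orbT.
have [ss0 ss1] := andP s01; have [p0 p1] := andP p01.
have hs : 1024 * 1024 <= s ^+ 3 * n%:R.
  rewrite /s minEle; case: ifP => _; rewrite ?expr1n ?mul1r; by move: An1 An2 x0 y0; clear; lra.
have hp : 1 + s <= (2 * n)%:R * p.
  have : s <= sigma by rewrite ge_min lexx.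
  by rewrite natrM; move: ps p0; clear; lra.
apply: le_trans (Pr_sat_exp_upper s01 p1 hp hs) _.
have sS : sigma ^+ 3 <= s ^+ 3 * (1 + M) ^+ 3.
  have le_s : sigma <= s * (1 + M).
    rewrite /s minEle; case: ifP => _; first by rewrite ler_peMr ?(ltW s0) // lerDl.
    by move: sM; clear; lra.
  by rewrite -exprMn lerXn2r // nnegrE ?(le_trans _ le_s) // ltW.
have V : ((1 + M) ^+ 3)^-1 * (sigma ^+ 3 * n%:R) <= s ^+ 3 * n%:R.
  by rewrite mulrC ler_pdivrMr // [leRHS]mulrAC ler_wpM2r.
rewrite ler_expR lerN2 invfM mulrAC.
by move: V; move: (_^-1 * _) => v; clear; lra.
Qed.

Local Open Scope classical_set_scope.
Local Open Scope ring_scope.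

Theorem theorem1p8 (R : realType) (p sigma : nat -> R)
    (hp : forall n, 0 <= p n <= 1)
    (hsigma : forall n, p n * (2 * n%:R - 1) = 1 + sigma n)
    (hbounded : exists M : R, forall n, p n * (2 * n%:R - 1) <= M)
    (hlarge : much_larger sigma (fun n : nat => n%:R `^ (- (1 / 3)))) :
  exists2 theta : nat -> R,
    theta \is 'Theta_\oo (fun n : nat => sigma n ^+ 3 * n%:R) &
    \forall n \near \oo,
      Pr_formula (p n) (fun F : formula n => ~~ satisfiable F)
        = 1 - expR (- theta n) /\
      Pr_formula (p n) (fun F : formula n => satisfiable F)
        = expR (- theta n).
Proof.
have [M hM] := hbounded.
have [c [C [A [c0 C0 hA]]]] := Pr_sat_two_sided (normr_ge0 M).
have large : \forall n \near \oo, [/\ 0 < sigma n <= `|M|, A <= sigma n ^+ 3 * n%:R & A <= n%:R].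
  (* For K = max 1 A, the bound sigma >= K n^(-1/3) gives sigma^3 n >= K^3 >= K >= A; the last chain
     uses K >= 1. *)
  have /cvgryPge/(_ (Num.max 1 A)) h := hlarge.
  near=> n; have n1 : 1 <= n%:R :> R by near: n; exact: nbhs_infty_ger.
  have n0 : 0 < n%:R :> R by exact: lt_le_trans n1.
  have hn : Num.max 1 A <= sigma n / n%:R `^ (- (1 / 3)) by near: n.
  have q0 : 0 < n%:R `^ (- (1 / 3)) :> R by exact: powR_gt0.
  have q3 : (n%:R `^ (- (1 / 3)) : R) ^+ 3 = n%:R^-1.
    rewrite -powR_mulrn ?ltW // -powRrM (_ : - (1 / 3) * 3%:R = -1); last by field.
    by rewrite powR_inv1 // ltW.
  have K1 : 1 <= Num.max 1 A by rewrite le_max lexx.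
  have KA : A <= Num.max 1 A by rewrite le_max lexx orbT.
  move: hn; rewrite ler_pdivlMr // => hn.
  have s0 : 0 < sigma n by apply: lt_le_trans hn; rewrite mulr_gt0 // (lt_le_trans ltr01).
  split.
  - rewrite s0 /=; apply: le_trans (ler_norm M); move: (hM n); rewrite hsigma; lra.
  - apply: (le_trans KA); apply: le_trans (ler_eXnr (n := 3) _ K1) _ => //.
    have : (Num.max 1 A * n%:R `^ (- (1 / 3))) ^+ 3 <= sigma n ^+ 3.
      by rewrite lerXn2r ?nnegrE ?(ltW s0) // mulr_ge0 ?ltW // (lt_le_trans ltr01).
    by rewrite exprMn q3 ler_pdivrMr.
  - by near: n; exact: nbhs_infty_ger.
pose P n := Pr (fun=> p n) (@satisfiable n).
have bounds : \forall n \near \oo, 0 < sigma n /\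
    expR (- (C * (sigma n ^+ 3 * n%:R))) <= P n <= expR (- (c * (sigma n ^+ 3 * n%:R))).
  near=> n; have [sM An1 An2] : [/\ 0 < sigma n <= `|M|, A <= sigma n ^+ 3 * n%:R & A <= n%:R].
    by near: n.
  by split; [case/andP: sM|exact: hA].
(* With this exponent both equalities are exact wherever P n is positive, and the order of growth is
   read off from the logarithms of the two bounds. *)
exists (fun n => - ln (P n)); last first.
  near=> n; have [s0 /andP[P1 P2]] : 0 < sigma n /\
    expR (- (C * (sigma n ^+ 3 * n%:R))) <= P n <= expR (- (c * (sigma n ^+ 3 * n%:R))) by near: n.
  have P0 : 0 < P n by apply: lt_le_trans P1; exact: expR_gt0.
  rewrite opprK lnK ?posrE // !Pr_formulaE; split => //.
  exact: PrC.
apply/asboolP; exists (c, C); rewrite /= ?c0 ?C0 //.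
near=> n; have [s0 /andP[P1 P2]] : 0 < sigma n /\
    expR (- (C * (sigma n ^+ 3 * n%:R))) <= P n <= expR (- (c * (sigma n ^+ 3 * n%:R))) by near: n.
have P0 : 0 < P n by apply: lt_le_trans P1; exact: expR_gt0.
have g0 : 0 <= sigma n ^+ 3 * n%:R by rewrite mulr_ge0 // exprn_ge0 // ltW.
have l2 : c * (sigma n ^+ 3 * n%:R) <= - ln (P n).
  by rewrite lerNr -[leRHS]expRK ler_ln ?posrE ?expR_gt0.
have l1 : - ln (P n) <= C * (sigma n ^+ 3 * n%:R).
  by rewrite lerNl -[leLHS]expRK ler_ln ?posrE ?expR_gt0.
rewrite (ger0_norm g0) ger0_norm ?(le_trans _ l2) //.
by rewrite mulr_ge0 // ltW.
Unshelve. all: by end_near.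
Qed.
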